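(* Let assumptions (a) and (b) of the context hold and let $\mathbb{M}$ be as in the context. Assume that there exist a constant $M>0$ and $N_0\in\mathbb{N}$ such that $$-\frac{\langle A(x)x,x\rangle}{\|x\|^2}+\tfrac12\mathrm{trace}A(x)+\langle\mathbf{G}(x),x\rangle\le M\|x\|^2\big(\ln\|x\|+1\big)$$ for a.e. $x\in\mathbb{R}^d\setminus\overline{B}_{N_0}$. Then $\mathbb{M}$ is non-explosive.
   Context: Let $d\ge2$, $p\in(d,\infty)$, $q=\frac{pd}{p+d}$. $B_r$ is the open Euclidean ball of radius $r$ about $0$. For a matrix $B=(b_{ij})$ of functions, $\nabla B$ is the vector field with $i$-th component $\sum_j\partial_jb_{ij}$. Assumption (a): $A=(a_{ij})$ with $a_{ji}=a_{ij}\in H^{1,2}_{loc}(\mathbb{R}^d)\cap C(\mathbb{R}^d)$, such that for every relatively compact $V$ there is $\nu_V>0$ with $\nu_V^{-1}\|\xi\|^2\le\langle A(x)\xi,\xi\rangle\le\nu_V\|\xi\|^2$ for all $\xi\in\mathbb{R}^d$, $x\in V$; $C=(c_{ij})$ with $-c_{ji}=c_{ij}\in H^{1,2}_{loc}(\mathbb{R}^d)\cap C(\mathbb{R}^d)$; $\mathbf{H}\in L^p_{loc}(\mathbb{R}^d,\mathbb{R}^d)$. Put $\mathbf{G}=(g_1,\dots,g_d)=\tfrac12\nabla(A+C^T)+\mathbf{H}$ and $Lf=\tfrac12\sum_{i,j}a_{ij}\partial_{ij}f+\sum_ig_i\partial_if$, $f\in C^2(\mathbb{R}^d)$. Assumption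 (b): $\mathbf{G}\in L^q_{loc}(\mathbb{R}^d,\mathbb{R}^d)$. Measure: $\mu=\rho\,dx$, where $\rho\in H^{1,p}_{loc}(\mathbb{R}^d)\cap C(\mathbb{R}^d)$, $\rho>0$ everywhere, and $\int Lf\,d\mu=0$ for all $f\in C_0^\infty(\mathbb{R}^d)$ (such $\rho$ exists under (a); one is fixed). Semigroup: put $\beta^{\rho,A}_i=\tfrac12\sum_j(\partial_ja_{ij}+a_{ij}\tfrac{\partial_j\rho}\rho)$, $\mathbf{B}=\mathbf{G}-\beta^{\rho,A}$. For relatively compact open $V$ let $(L^{0,V},D(L^{0,V}))$ be the self-adjoint generator on $L^2(V,\mu)$ of the closure of $\tfrac12\int_V\langle A\nabla u,\nabla v\rangle d\mu$, $u,v\in C_0^\infty(V)$. The operator $L^{0,V}u+\langle\mathbf{B},\nabla u\rangle$ on bounded $u\in D(L^{0,V})$ is closable in $L^1(V,\mu)$ and its closure generates a sub-Markovian $C_0$-semigroup of contractions, with resolvent $\overline{G}^V_\alpha$; put $\overline{G}^V_\alpha f:=\overline{G}^V_\alpha(f1_V)$ (zero outside $V$) for $f\in L^1(\mathbb{R}^d,\mu)$. For relatively compact open $V_n\uparrow\mathbb{R}^d$ the limits $\overline{G}_\alpha f=\lim_n\overline{G}^{V_n}_\alpha f$ exist in $L^1(\mathbb{R}^d,\mu)$, do not depend on $(V_n)$, and form the resolvent of a sub-Markovian $C_0$-semigroup of contractions $(\overline{T}_t)_{t>0}$ on $L^1(\mathbb{R}^d,\mu)$, whose generator extends $(L,C_0^\infty(\mathbb{R}^d))$.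 $(T_t)_{t>0}$ denotes the sub-Markovian semigroup on every $L^s(\mathbb{R}^d,\mu)$, $s\in[1,\infty]$, obtained by restricting $(\overline{T}_t)$ to $L^1\cap L^\infty$ and extending. For $f\in\bigcup_{s\in[1,\infty]}L^s(\mathbb{R}^d,\mu)$ and $t>0$, $T_tf$ has a continuous $\mu$-version, denoted $P_tf$; $P_0=\mathrm{id}$. Process: under (a) and (b), $\mathbb{M}=(\Omega,\mathcal{F},(\mathcal{F}_t)_{t\ge0},(X_t)_{t\ge0},(\mathbb{P}_x)_{x\in\mathbb{R}^d\cup\{\Delta\}})$ is the Hunt process with state space $\mathbb{R}^d$, with continuous sample paths on the one-point compactification $\mathbb{R}^d_\Delta$ (absorbed at $\Delta$ after the lifetime $\zeta=\inf\{t\ge0:X_t=\Delta\}$), such that $P_tf(x)=\mathbb{E}_x[f(X_t)]$ for all $t\ge0$, $x\in\mathbb{R}^d$, $f$ bounded Borel, with $f(\Delta):=0$. $\mathbb{M}$ is non-explosive if $\mathbb{P}_x(\zeta=\infty)=1$ for all $x\in\mathbb{R}^d$. *)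

(* Defs.v *)
From HB Require Import structures.
From mathcomp Require Import all_boot all_order all_algebra.
From mathcomp Require Import all_classical all_reals all_analysis.
From mathcomp Require Import measurable_realfun.

Set Implicit Arguments.
Unset Strict Implicit.
Unset Printing Implicit Defensive.
Import Order.TTheory GRing.Theory Num.Theory.
Import numFieldNormedType.Exports.
Local Open Scope classical_set_scope.
Local Open Scope ring_scope.

Fact borel_display : measure_display. Proof. exact: default_measure_display. Qed.

Section borel_rV.
Variables (R : realType) (d : nat).
Let borel := <<s @open 'rV[R]_d >>.
Let borel0 : borel set0. Proof. exact: sigma_algebra0. Qed.
Let borelC A : borel A -> borel (~` A). Proof. exact: sigma_algebraC. Qed.
Let borelU (F : (set 'rV[R]_d)^nat) :
  (forall i, borel (F i)) -> borel (\bigcup_i F i).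
Proof. exact: sigma_algebra_bigcup. Qed.
HB.instance Definition _ := @isMeasurable.Build borel_display 'rV[R]_d
  borel borel0 borelC borelU.
End borel_rV.

Section borel_opc.
Variable X : topologicalType.
Local Notation opc := (one_point_compactification X).
Let borel := <<s @open opc >>.
Let borel0 : borel set0. Proof. exact: sigma_algebra0. Qed.
Let borelC A : borel A -> borel (~` A). Proof. exact: sigma_algebraC. Qed.
Let borelU (F : (set opc)^nat) :
  (forall i, borel (F i)) -> borel (\bigcup_i F i).
Proof. exact: sigma_algebra_bigcup. Qed.
HB.instance Definition _ := @isMeasurable.Build borel_display opc
  borel borel0 borelC borelU.
End borel_opc.

Section lebesgue_rV.
Variable R : realType.
Local Notation tupleR n := (n.-tuple (measurableTypeR R)).

Definition consT n (z : measurableTypeR R * tupleR n) : tupleR n.+1 :=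
  [tuple of z.1 :: z.2].

Lemma measurable_consT n : measurable_fun setT (@consT n).
Proof. exact: measurable_cons. Qed.

Section lebesgue_cons.
Variables (n : nat) (m : {sigma_finite_measure set (tupleR n) -> \bar R}).

Definition lebesgue_cons : set (tupleR n.+1) -> \bar R :=
  pushforward (@lebesgue_measure R \x m)%E (@consT n).

HB.instance Definition _ := Measure.copy lebesgue_cons
  (measure_function_pushforward__canonical__measure_function_Measure
    (@lebesgue_measure R \x m)%E (@measurable_consT n)).

Lemma lebesgue_cons_sigma_finite : sigma_finite setT lebesgue_cons.
Proof.
have /sigma_finiteP[F [TF ndF Foo]] :=
  @sigma_finiteT _ _ _ (@lebesgue_measure R : {sigma_finite_measure set _ -> \bar R}).
have /sigma_finiteP[G [TG ndG Goo]] := sigma_finiteT m.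
pose g (t : tupleR n.+1) : measurableTypeR R * tupleR n :=
  (thead t, [tuple of behead t]).
have mg : measurable_fun setT g.
  by apply/measurable_fun_pairP; split; [exact: measurable_tnth|exact: measurable_behead].
exists (fun i => g @^-1` (F i `*` G i)).
  apply/seteqP; split => // t _.
  have [i _ Fi] : (\bigcup_i F i) (thead t) by rewrite -TF.
  have [j _ Gj] : (\bigcup_i G i) [tuple of behead t] by rewrite -TG.
  exists (maxn i j) => //; split => /=.
    by move: Fi; exact/subsetPset/ndF/leq_maxl.
  by move: Gj; exact/subsetPset/ndG/leq_maxr.
move=> i; have [mF Fi] := Foo i; have [mG Gi] := Goo i.
have mFG : measurable (F i `*` G i) by exact: measurableX.
split; first by rewrite -[X in measurable X]setTI; exact: mg.
rewrite /lebesgue_cons /pushforward -comp_preimage (_ : g \o _ = id).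
  by rewrite preimage_id product_measure1E// lte_mul_pinfty// ge0_fin_numE.
by apply/funext => -[x t]; rewrite /g/= theadE; congr pair; exact/val_inj.
Qed.

HB.instance Definition _ := Measure_isSigmaFinite.Build _ _ _ lebesgue_cons
  lebesgue_cons_sigma_finite.
End lebesgue_cons.

(* Iterated product of the one-dimensional Lebesgue measure. *)
Fixpoint lebesgue_tuple n : {sigma_finite_measure set (tupleR n) -> \bar R} :=
  match n with
  | 0 => \d_([tuple] : tupleR 0)
  | n'.+1 => lebesgue_cons (lebesgue_tuple n')
  end.

Definition row_of_tuple d (t : tupleR d) : 'rV[R]_d := \row_i tnth t i.

Lemma measurable_row_of_tuple d : measurable_fun setT (@row_of_tuple d).
Proof.
apply: (measurability (@open 'rV[R]_d)); first by [].
move=> _ [U oU <-]; rewrite setTI.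
pose box (q : {ffun 'I_d -> rat * rat}) : set (tupleR d) :=
  [set t | forall i, ratr (q i).1 < tnth t i < ratr (q i).2].
pose B q := [set t | box q t /\ box q `<=` @row_of_tuple d @^-1` U].
have -> : @row_of_tuple d @^-1` U = \bigcup_q B q.
  apply/seteqP; split => [t Ut|t [q _ [qt]]]; last exact.
  have [P Pt PU] := open_nbhs_nbhs (conj oU Ut : open_nbhs _ _).
  have /choice[q qP] : forall i, exists q : rat * rat,
      ratr q.1 < tnth t i < ratr q.2 /\
      (forall y : R, ratr q.1 < y < ratr q.2 -> P ord0 i y).
    move=> i; have /= := Pt ord0 i; rewrite mxE => /nbhs_ballP[e/= e0 eP].
    have /rat_in_itvoo[q1 /itvP q1P] : tnth t i - e < tnth t i.
      by rewrite ltrBlDr ltrDl.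
    have /rat_in_itvoo[q2 /itvP q2P] : tnth t i < tnth t i + e.
      by rewrite ltrDl.
    exists (q1, q2); split => /=; first by rewrite q1P q2P.
    move=> y /andP[y1 y2]; apply: eP.
    rewrite /ball/= distrC ltr_distl (lt_trans _ y1) ?q1P//=.
    by rewrite (lt_trans y2) ?q2P.
  exists [ffun i => q i] => //; split => [i|s bs]; first by rewrite ffunE; have [] := qP i.
  apply: PU => i j; rewrite ord1 mxE; have [_] := qP j; apply => /=.
  by have := bs j; rewrite ffunE.
apply: countable_bigcupT_measurable => [|q]; first exact: countableP.
have [bU|nbU] := pselect (box q `<=` @row_of_tuple d @^-1` U); last first.
  by rewrite (_ : B q = set0)//; apply/seteqP; split => // t [].
rewrite (_ : B q = \bigcap_(i in [set: 'I_d])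
    ((@tnth d (measurableTypeR R))^~ i @^-1` [set` `]ratr (q i).1, ratr (q i).2[])).
  apply: fin_bigcap_measurable => [|i _]; first exact: finite_finset.
  by rewrite -[X in measurable X]setTI; apply: measurable_tnth => //; exact: measurable_itv.
apply/seteqP; split => [t [qt _] i _|t qt]; first exact: qt.
by split => // i; exact: qt.
Qed.

Definition lebesgue_rV d : set 'rV[R]_d -> \bar R :=
  pushforward (lebesgue_tuple d) (@row_of_tuple d).

HB.instance Definition _ d := Measure.copy (@lebesgue_rV d)
  (measure_function_pushforward__canonical__measure_function_Measure
    (lebesgue_tuple d) (@measurable_row_of_tuple d)).

End lebesgue_rV.

Section differential_operators.
Variables (R : realType) (d : nat).
Local Notation E := 'rV[R]_d.
Local Notation leb := (@lebesgue_rV R d).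
Implicit Types (u v : E) (f : E -> R) (V : set E).

Definition dot u v : R := \sum_i u ord0 i * v ord0 i.

(* Euclidean norm; the library norm of 'rV[R]_d is the sup norm. *)
Definition enorm u : R := Num.sqrt (dot u u).

(* [B] applied to the column vector represented by the row vector [u]. *)
Definition mxact (B : 'M[R]_d) u : E := u *m B^T.

Definition relatively_compact V := compact (closure V).

Definition pderiv (i : 'I_d) f : E -> R := 'D_(delta_mx ord0 i) f.

Definition grad f : E -> E := fun x => \row_i pderiv i f x.

Fixpoint Ck (k : nat) f : Prop :=
  match k with
  | 0 => continuous f
  | k'.+1 => continuous f /\ forall i,
      (forall x, derivable f x (delta_mx ord0 i)) /\ Ck k' (pderiv i f)
  end.

Definition test_fun V f : Prop :=
  [/\ forall k, Ck k f,
      compact (closure [set x | f x != 0]) &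
      closure [set x | f x != 0] `<=` V].

Definition Lloc V (s : R) f : Prop :=
  measurable_fun setT f /\
  forall K, compact K -> K `<=` V -> (f \_ K) \in Lfun leb s%:E.

Definition is_weak_pderiv V (i : 'I_d) f g : Prop :=
  [/\ Lloc V 1 f, Lloc V 1 g & forall phi, test_fun V phi ->
      \int[leb]_x (f x * pderiv i phi x) = - \int[leb]_x (g x * phi x)].

(* A fixed version of the (a.e. unique) weak derivative, 0 if there is none. *)
Definition weak_pderiv V (i : 'I_d) f : E -> R :=
  xget (fun=> 0) [set g | is_weak_pderiv V i f g].

Definition weak_grad V f : E -> E := fun x => \row_i weak_pderiv V i f x.

Definition H1loc (s : R) f : Prop :=
  Lloc setT s f /\
  forall i, exists2 g, Lloc setT s g & is_weak_pderiv setT i f g.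

(* The vector field with i-th component [\sum_j d_j b_ij]. *)
Definition mx_grad (B : E -> 'M[R]_d) : E -> E :=
  fun x => \row_i \sum_j weak_pderiv setT j (fun y => B y i j) x.

Definition driftG (A C : E -> 'M[R]_d) (H : E -> E) : E -> E :=
  fun x => 2^-1 *: mx_grad (fun y => A y + (C y)^T) x + H x.

Definition operL (A : E -> 'M[R]_d) (G : E -> E) f : E -> R := fun x =>
  2^-1 * (\sum_i \sum_j A x i j * pderiv i (pderiv j f) x) + dot (G x) (grad f x).

Definition beta (rho : E -> R) (A : E -> 'M[R]_d) : E -> E := fun x =>
  2^-1 *: (mx_grad A x
           + (rho x)^-1 *: mxact (A x) (weak_grad setT rho x)).

Record assumption_a (p : R) (A C : E -> 'M[R]_d) (H : E -> E) : Prop := {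
  A_sym : forall x, (A x)^T = A x ;
  A_H1loc : forall i j, H1loc 2 (fun x => A x i j) ;
  A_continuous : forall i j, continuous (fun x => A x i j : R) ;
  A_elliptic : forall V, relatively_compact V -> exists2 nu : R, 0 < nu &
    forall x xi, V x ->
      nu^-1 * enorm xi ^+ 2 <= dot (mxact (A x) xi) xi <= nu * enorm xi ^+ 2 ;
  C_antisym : forall x, (C x)^T = - C x ;
  C_H1loc : forall i j, H1loc 2 (fun x => C x i j) ;
  C_continuous : forall i j, continuous (fun x => C x i j : R) ;
  H_Lploc : forall i, Lloc setT p (fun x => H x ord0 i) }.

Definition assumption_b (p : R) (A C : E -> 'M[R]_d) (H : E -> E) : Prop :=
  forall i, Lloc setT (p * d%:R / (p + d%:R)) (fun x => driftG A C H x ord0 i).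

Record invariant_density (p : R) (A : E -> 'M[R]_d) (G : E -> E)
    (rho : E -> R) (mu : {measure set E -> \bar R}) : Prop := {
  rho_H1loc : H1loc p rho ;
  rho_continuous : continuous rho ;
  rho_gt0 : forall x, 0 < rho x ;
  mu_density : forall B, measurable B ->
    mu B = (\int[leb]_(x in B) (rho x)%:E)%E ;
  mu_invariant : forall f, test_fun setT f -> \int[mu]_x operL A G f x = 0 }.

End differential_operators.

Section L1_semigroups.
Variables (R : realType) (d : nat).
Local Notation E := 'rV[R]_d.
Variable mu : {measure set E -> \bar R}.
Implicit Types (f g u w : E -> R) (D : set E).
Implicit Types (S : R -> (E -> R) -> (E -> R)).

(* L^s(D, mu), realized by the functions on the whole space vanishing off D;
   equality of elements is equality mu-a.e. *)
Definition Lp_on D (s : \bar R) f : Prop :=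
  f \in Lfun mu s /\ forall x, ~ D x -> f x = 0.

Definition Lp_dist (s : \bar R) f g : \bar R :=
  ('N[mu]_s [ EFin \o (f \- g)%R ])%E.

Definition Lp_cvg (s : \bar R) (fn : nat -> E -> R) f : Prop :=
  Lp_dist s (fn n) f @[n --> \oo] --> 0%E.

Record sub_markovian_C0_contraction_semigroup D S : Prop := {
  sg_L1 : forall t f, 0 < t -> Lp_on D 1 f -> Lp_on D 1 (S t f) ;
  sg_ae : forall t f g, 0 < t -> Lp_on D 1 f -> Lp_on D 1 g ->
    f = g %[ae mu] -> S t f = S t g %[ae mu] ;
  sg_linear : forall t (a : R) f g, 0 < t -> Lp_on D 1 f -> Lp_on D 1 g ->
    S t (a \*o f \+ g) = a \*o S t f \+ S t g %[ae mu] ;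
  sg_add : forall s t f, 0 < s -> 0 < t -> Lp_on D 1 f ->
    S (s + t) f = S s (S t f) %[ae mu] ;
  sg_contraction : forall t f, 0 < t -> Lp_on D 1 f ->
    ('N[mu]_1 [ EFin \o S t f ] <= 'N[mu]_1 [ EFin \o f ])%E ;
  sg_strongly_continuous : forall f, Lp_on D 1 f ->
    Lp_dist 1 (S t f) f @[t --> 0^'+] --> 0%E ;
  sg_sub_markovian : forall t f, 0 < t -> Lp_on D 1 f ->
    {ae mu, forall x, 0 <= f x <= 1} -> {ae mu, forall x, 0 <= S t f x <= 1} }.

Definition generator D S u w : Prop :=
  [/\ Lp_on D 1 u, Lp_on D 1 w &
      Lp_dist 1 (fun x => t^-1 * (S t u x - u x)) w @[t --> 0^'+] --> 0%E].

Definition L1_closure D (gen : (E -> R) -> (E -> R) -> Prop) u w : Prop :=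
  [/\ Lp_on D 1 u, Lp_on D 1 w & exists un wn : nat -> E -> R,
      [/\ forall n, gen (un n) (wn n), Lp_cvg 1 un u & Lp_cvg 1 wn w]].

(* [Gr alpha] is the inverse of [alpha - gen] on L^1(D, mu). *)
Definition is_resolvent D (gen : (E -> R) -> (E -> R) -> Prop)
    (Gr : R -> (E -> R) -> (E -> R)) : Prop :=
  forall alpha f, 0 < alpha -> Lp_on D 1 f ->
    gen (Gr alpha f) (fun x => alpha * Gr alpha f x - f x).

End L1_semigroups.

Section associated_semigroup.
Variables (R : realType) (d : nat).
Local Notation E := 'rV[R]_d.
Variables (mu : {measure set E -> \bar R}) (A : E -> 'M[R]_d) (G B : E -> E).
Implicit Types (f g u v w : E -> R) (V : set E).

Definition energy V u v : R :=
  2^-1 * \int[mu]_(x in V) dot (mxact (A x) (grad u x)) (grad v x).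

Definition energy_approx V u (phi : nat -> E -> R) : Prop :=
  [/\ forall n, test_fun V (phi n),
      Lp_cvg mu 2%:E phi u &
      forall e : R, 0 < e -> exists N, forall m n, (N <= m)%N -> (N <= n)%N ->
        energy V (phi m \- phi n) (phi m \- phi n) < e].

(* Domain and values of the closure of [energy V] on the test functions. *)
Definition form_dom V u : Prop :=
  Lp_on mu V 2%:E u /\ exists phi, energy_approx V u phi.

Definition form_val V u v (e : R) : Prop :=
  exists phi psi, [/\ energy_approx V u phi, energy_approx V v psi &
    energy V (phi n) (psi n) @[n --> \oo] --> e].

(* u is in D(L^{0,V}) and L^{0,V} u = w. *)
Definition form_generator V u w : Prop :=
  [/\ form_dom V u, Lp_on mu V 2%:E w & forall v, form_dom V v ->
      form_val V u v (- \int[mu]_(x in V) (w x * v x))].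

(* The operator L^{0,V} u + <B, grad u> on the bounded u in D(L^{0,V}). *)
Definition part_operator V u w : Prop :=
  u \in Lfun mu +oo%E /\ exists2 l, form_generator V u l &
    w = (fun x => l x + dot (B x) (weak_grad V u x)) \_ V.

Definition part_resolvent V (GV : R -> (E -> R) -> (E -> R)) : Prop :=
  exists S, [/\ sub_markovian_C0_contraction_semigroup mu V S,
    forall u w, generator mu V S u w <-> L1_closure mu V (part_operator V) u w &
    is_resolvent mu V (generator mu V S) GV].

Definition exhaustion (Vn : nat -> set E) : Prop :=
  [/\ forall n, open (Vn n) /\ relatively_compact (Vn n),
      forall n, Vn n `<=` Vn n.+1 &
      \bigcup_n Vn n = setT].

Definition associated_semigroup (T : R -> (E -> R) -> (E -> R)) : Prop :=
  exists (GV : set E -> R -> (E -> R) -> (E -> R))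
         (Gr : R -> (E -> R) -> (E -> R)),
  [/\ forall V, open V -> relatively_compact V -> part_resolvent V (GV V),
      forall Vn alpha f, exhaustion Vn -> 0 < alpha -> Lp_on mu setT 1 f ->
        Lp_cvg mu 1 (fun n => GV (Vn n) alpha (f \_ (Vn n))) (Gr alpha f),
      sub_markovian_C0_contraction_semigroup mu setT T,
      is_resolvent mu setT (generator mu setT T) Gr &
      forall f, test_fun setT f -> generator mu setT T f (operL A G f)].

(* The extension to L^s(mu) of the restriction of T to L^1 and L^oo: by density
   for s < +oo; for s = +oo along the truncations of f to balls, which for
   f >= 0 increase to f, so that the limit exists a.e. by positivity. *)
Definition Ls_extension (T : R -> (E -> R) -> (E -> R)) (s : \bar R) (t : R)
    f g : Prop :=
  match s with
  | +oo%E => {ae mu, forall x,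
      T t (f \_ [set y | enorm y < n%:R]) x @[n --> \oo] --> g x}
  | _ => exists fn : nat -> E -> R,
      [/\ forall n, fn n \in Lfun mu 1 /\ fn n \in Lfun mu +oo%E,
          Lp_cvg mu s fn f & Lp_cvg mu s (fun n => T t (fn n)) g]
  end.

Record continuous_versions (T P : R -> (E -> R) -> (E -> R)) : Prop := {
  P_0 : forall f, P 0 f = f ;
  P_continuous : forall (s : \bar R) t f, (1 <= s)%E -> f \in Lfun mu s ->
    0 < t -> continuous (P t f) ;
  P_version : forall (s : \bar R) t f, (1 <= s)%E -> f \in Lfun mu s ->
    0 < t -> Ls_extension T s t f (P t f) }.

End associated_semigroup.

Section hunt_processes.
Variables (R : realType) (d : nat) (dO : measure_display).
Variable Omega : measurableType dO.
Local Notation E := 'rV[R]_d.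
Local Notation ED := (one_point_compactification E).

Definition stopping_time (F : R -> set (set Omega)) (sigma : Omega -> \bar R) :=
  (forall w, 0 <= sigma w)%E /\
  forall t : R, 0 <= t -> F t [set w | (sigma w <= t%:E)%E].

Definition stopped_sigma_algebra (F : R -> set (set Omega))
    (sigma : Omega -> \bar R) (Gamma : set Omega) :=
  measurable Gamma /\
  forall t : R, 0 <= t -> F t (Gamma `&` [set w | (sigma w <= t%:E)%E]).

(* The cemetery point is [None]; times are the reals t >= 0. *)
Record hunt_process := {
  hF : R -> set (set Omega) ;
  hX : R -> Omega -> ED ;
  hshift : R -> Omega -> Omega ;
  hP : ED -> probability Omega R ;
  hF_sigma_algebra : forall t : R, 0 <= t -> sigma_algebra setT (hF t) ;
  hF_measurable : forall t : R, 0 <= t -> hF t `<=` measurable ;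
  hF_nondecreasing : forall (s t : R), 0 <= s -> s <= t -> hF s `<=` hF t ;
  hF_right_continuous : forall t : R, 0 <= t ->
    \bigcap_(s in [set s : R | t < s]) hF s `<=` hF t ;
  hX_adapted : forall (t : R) (B : set ED), 0 <= t -> measurable B -> hF t (hX t @^-1` B) ;
  hX_shift : forall (s t : R) w, 0 <= s -> 0 <= t ->
    hX s (hshift t w) = hX (s + t) w ;
  hX_absorbed : forall (s t : R) w, 0 <= s -> s <= t -> hX s w = None -> hX t w = None ;
  hP_borel : forall Gamma,
    <<s [set Y | exists (t : R) (B : set ED), [/\ 0 <= t, measurable B & Y = hX t @^-1` B]] >>
      Gamma -> measurable_fun [set: ED] (fun z => hP z Gamma) ;
  hP_universally_measurable : forall (Q : probability ED R) Gamma,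
    measurable Gamma -> exists2 h : ED -> \bar R, measurable_fun setT h &
      {ae Q, forall z, hP z Gamma = h z} ;
  hP_normal : forall z, hP z (hX 0 @^-1` [set z]) = 1%E ;
  hX_continuous : forall w,
    {within [set t : R | 0 <= t], continuous (fun t => hX t w)} ;
  hP_strong_markov : forall z sigma Gamma (t : R) (B : set ED),
    stopping_time hF sigma -> stopped_sigma_algebra hF sigma Gamma ->
    0 <= t -> measurable B ->
    hP z (Gamma `&` [set w | (sigma w < +oo)%E /\ B (hX (fine (sigma w) + t) w)])
    = (\int[hP z]_(w in Gamma `&` [set w | (sigma w < +oo)%E])
         hP (hX (fine (sigma w)) w) (hX t @^-1` B))%E ;
  hP_quasi_left_continuous : forall z (sigman : nat -> Omega -> \bar R) sigma,
    (forall n, stopping_time hF (sigman n)) -> stopping_time hF sigma ->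
    (forall w, nondecreasing_seq (fun n => sigman n w)) ->
    (forall w, sigman n w @[n --> \oo] --> sigma w) ->
    {ae hP z, forall w, (sigma w < +oo)%E ->
      hX (fine (sigman n w)) w @[n --> \oo] --> hX (fine (sigma w)) w} }.

Definition lifetime (M : hunt_process) (w : Omega) : \bar R :=
  ereal_inf [set t%:E | t in [set t : R | 0 <= t /\ hX M t w = None]].

Definition has_transition (P : R -> (E -> R) -> (E -> R)) (M : hunt_process) :=
  forall (t : R) (x : E) (f : E -> R), 0 <= t -> measurable_fun setT f ->
    (exists c : R, forall y, `|f y| <= c) ->
    P t f x = \int[hP M (Some x)]_w oapp f 0 (hX M t w).

Definition non_explosive (M : hunt_process) : Prop :=
  forall x : E, hP M (Some x) [set w | lifetime M w = +oo%E] = 1%E.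

End hunt_processes.

(* Main.v *)
(** Only the following is needed about the semigroup: it is sub-Markovian and
    contractive on L^1(mu), and its generator extends L on test functions. Take
    f_m(x) = E(m - eta(|x|^2)) / m, where E is smooth, convex, vanishes on
    ]-oo, 0] and has slope at most 1, and eta is smooth, vanishes on |x| <= N_0
    (where the drift is not controlled) and behaves like ln |x|^2 at infinity.
    These are test functions tending to 1 locally uniformly, and since
    ln |x| + 1 grows like eta, the hypothesis gives
    alpha f_m - L f_m <= alpha + O(1/m) for a large alpha. A discrete Gronwall
    argument along T_(kh) f_m then shows that, for bounded D, the integral over
    D of T_t f_m tends to mu(D). Hence P_t 1 = 1 almost everywhere, and
    everywhere because P_t 1 is continuous and mu charges open sets; so the
    process is a.s. alive at all integer times. *)

Require Import Defs.
From HB Require Import structures.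
From mathcomp Require Import all_boot all_order all_algebra.
From mathcomp Require Import all_classical all_reals all_analysis.
From mathcomp Require Import measurable_realfun ess_sup_inf.
From mathcomp Require Import ring lra.

Set Implicit Arguments.
Unset Strict Implicit.
Unset Printing Implicit Defensive.

Import Order.TTheory GRing.Theory Num.Theory.
Import numFieldNormedType.Exports.
Local Open Scope classical_set_scope.
Local Open Scope ring_scope.

(** * Flat functions on the line *)

(** Two obstacles shape [f_m]. First, A is bounded only on bounded sets, so the second order part of
    [L f_m] is controlled at infinity by its sign alone. The term -<A x, x> / |x|^2 of the
    hypothesis, combined with the second derivative of eta, leaves <A x, x> times a factor that is
    nonpositive once eta is concave as a function of ln |x|^2; this can fail only in a bounded
    transition zone, where A is bounded. Second, the first order part grows like eta, without a
    bound uniform in m. Convexity of E with E(0) = 0 absorbs it: at y = m - eta, E(y) <= y E'(y), so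
    alpha E(y) + alpha (1 + eta) E'(y) <= alpha (m + 1) E'(y), and dividing by m leaves alpha +
    alpha / m.

    The semigroup acts on classes modulo null sets, so the comparison is made for integrals over D
    rather than pointwise. *)

Section smooth_line.
Variable R : realType.
Implicit Types (f g : R -> R) (n : nat) (p q : {poly R}).

(** The derivative is asked for as a witness, so that each closure lemma can name it by a formula
    and recurse on that formula. *)
Fixpoint differentiable_times n f : Prop :=
  match n with
  | 0 => True
  | n'.+1 => exists2 f' : R -> R, (forall x : R, is_derive x (1 : R) f (f' x)) &
               differentiable_times n' f'
  end.

Definition smooth f := forall n, differentiable_times n f.

Lemma differentiable_timesW n f :
  differentiable_times n.+1 f -> differentiable_times n f.
Proof.
elim: n f => [//|n IHn] f [f' ff' f'n]; exists f' => //; exact: IHn.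
Qed.

Lemma differentiable_times_cst n (a : R) : differentiable_times n (fun=> a).
Proof.
elim: n a => [//|n IHn] a; exists (fun=> 0) => // x.
exact: is_derive_cst.
Qed.

Lemma differentiable_timesD n f g : differentiable_times n f ->
  differentiable_times n g -> differentiable_times n (fun x => f x + g x).
Proof.
elim: n f g => [//|n IHn] f g [f' ff' f'n] [g' gg' g'n].
exists (fun x => f' x + g' x); last exact: IHn.
by move=> x; apply: (@is_deriveD _ _ _ f g).
Qed.

Lemma differentiable_timesM n f g : differentiable_times n f ->
  differentiable_times n g -> differentiable_times n (fun x => f x * g x).
Proof.
elim: n f g => [//|n IHn] f g fn gn.
have := (fn, gn) => -[[f' ff' f'n] [g' gg' g'n]].
exists (fun x => f x * g' x + g x * f' x).
  by move=> x; apply: (@is_deriveM _ _ f g).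
by apply: differentiable_timesD; apply: IHn => //; exact: differentiable_timesW.
Qed.

Lemma differentiable_times_comp n f g : differentiable_times n f ->
  differentiable_times n g -> differentiable_times n (fun x => f (g x)).
Proof.
elim: n f g => [//|n IHn] f g [f' ff' f'n] gn.
have := gn => -[g' gg' g'n]; exists (fun x => f' (g x) * g' x).
  by move=> x; apply: (@is_derive1_comp _ f g).
by apply: differentiable_timesM => //; apply: IHn => //; exact: differentiable_timesW.
Qed.

Lemma differentiable_timesV n f : (forall x, f x != 0) ->
  differentiable_times n f -> differentiable_times n (fun x => (f x)^-1).
Proof.
move=> f0; elim: n => [//|n IHn] fn.
have fVn := IHn (differentiable_timesW fn).
have := fn => -[f' ff' f'n].
exists (fun x => (-1) * ((f x)^-1 * (f x)^-1) * f' x).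
  move=> x; apply: (is_derive_eq (is_deriveV (f0 x) (ff' x))).
  by rewrite /GRing.scale/= expr2 invfM mulN1r.
apply: differentiable_timesM => //; apply: differentiable_timesM.
  exact: differentiable_times_cst.
exact: differentiable_timesM.
Qed.

Lemma differentiable_times_ln n f : (forall x, 0 < f x) ->
  differentiable_times n f -> differentiable_times n (fun x => ln (f x)).
Proof.
move=> f0; case: n => [//|n] fn.
have := fn => -[f' ff' f'n].
exists (fun x => (f x)^-1 * f' x).
  move=> x; apply: (@is_derive1_comp _ (@ln R) f).
  exact: is_derive1_ln.
apply: differentiable_timesM => //; apply: differentiable_timesV.
  by move=> x; rewrite gt_eqF.
exact: differentiable_timesW.
Qed.

(* p(1/z) exp(-1/z) on z > 0, extended by 0; the derivatives of such functions
   are again of this form. *)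
Definition flat p (z : R) := if 0 < z then p.[z^-1] * expR (- z^-1) else 0.

Lemma exprn_le_fact_expR n (u : R) : 0 <= u -> u ^+ n <= n`!%:R * expR u.
Proof.
move=> u0; case: n => [|n].
  by rewrite expr0 fact0 mul1r -expR0 ler_expR.
rewrite mulrC -ler_pdivrMr ?ltr0n ?fact_gt0//.
by apply: le_trans (expR_ge1Dxn n u0); rewrite lerDr.
Qed.

(** With u = 1/z, each monomial satisfies u^i <= i! exp u, so the coefficient of degree i costs at
    most its modulus times i!. *)
Lemma flat_bounded p : exists2 c, 0 <= c & forall z, `|flat p z| <= c.
Proof.
exists (\sum_(i < size p) `|p`_i| * i`!%:R).
  by apply: sumr_ge0 => i _; rewrite mulr_ge0.
move=> z; rewrite /flat; case: ifPn => [z0|_]; last first.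
  by rewrite normr0; apply: sumr_ge0 => i _; rewrite mulr_ge0.
have u0 : 0 <= z^-1 by rewrite invr_ge0 ltW.
rewrite normrM (gtr0_norm (expR_gt0 _)) expRN.
rewrite ler_pdivrMr ?expR_gt0// horner_coef mulr_suml.
apply: le_trans (ler_norm_sum _ _ _) _; apply: ler_sum => i _.
rewrite normrM -mulrA ler_wpM2l// ger0_norm ?exprn_ge0//.
exact: exprn_le_fact_expR.
Qed.

Lemma flatXM p z : flat p z = z * flat ('X * p) z.
Proof.
rewrite /flat; case: ifPn => [z0|_]; last by rewrite mulr0.
by rewrite hornerM hornerX !mulrA divff ?gt_eqF// mul1r.
Qed.

Lemma is_derive_flat p z : is_derive z (1 : R) (flat p) (flat ('X^2 * (p - p^`())) z).
Proof.
have [z0|z0|->] := ltgtP z 0.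
- have -> : flat ('X^2 * (p - p^`())) z = 0 by rewrite /flat ltNge (ltW z0).
  apply: near_eq_is_derive (is_derive_cst (0 : R) z (1 : R)).
  near=> y; rewrite /flat/= ifF//; apply/negbTE; rewrite -leNgt.
  by near: y; exact: lt_le_nbhsl.
- have dV : is_derive z (1 : R) (fun y : R => y^-1) (- z ^- 2).
    apply: (is_derive_eq (@is_deriveV _ id z 1 1 (lt0r_neq0 z0) _)).
    by rewrite /GRing.scale/= mulr1.
  have dp := @is_derive1_comp _ (horner p) (fun y => y^-1) z _ _ (is_derive_poly p _) dV.
  have de := @is_derive1_comp _ (@expR R) (fun y => - y^-1) z _ _ (is_derive_expR _) (@is_deriveN _ _ _ _ _ _ _ dV).
  apply: (is_derive_eq (near_eq_is_derive _ (is_deriveM dp de))).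
    near=> y; rewrite /flat ifT//.
    by near: y; exact: lt_nbhsr.
  rewrite /flat z0 /GRing.scale/= !hornerE exprVn.
  have e (a b c v : R) : a * b * - - c + b * v * - c = c * (a - v) * b by ring.
  exact: e.
(* At the origin a factor z is drawn out twice with [flatXM]: once for the difference quotient,
   which is [flat ('X * p)], and once more to see that this quotient is O(z), hence continuous with
   value 0. *)
- have [c c0 pc] := flat_bounded ('X * ('X * p)).
  apply/is_derive1_caratheodory; exists (flat ('X * p)); split => //.
  + by move=> y; rewrite {2}/flat ltxx !subr0 mulrC -flatXM.
  + apply/cvgrPdist_lt => e e0; near=> y.
    rewrite {1}/flat ltxx sub0r normrN flatXM normrM.
    have : `|y| < e / (c + 1).
      near: y; apply: (@pseudometric_normed_Zmodule.nbhs0_lt R R); rewrite divr_gt0// ltr_wpDl//.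
    rewrite ltr_pdivlMr ?ltr_wpDl//; apply: le_lt_trans.
    by rewrite ler_wpM2l// (le_trans (pc y))// lerDl.
  + by rewrite /flat ltxx.
Unshelve. all: by end_near. Qed.

Lemma smooth_flat p : smooth (flat p).
Proof.
move=> n; elim: n p => [//|n IHn] p.
by exists (flat ('X^2 * (p - p^`()))) => // x; exact: is_derive_flat.
Qed.

(** The function E of the overview: z exp(-1/z) on z > 0. Its slope is [flat (1 + 'X)] and its
    second derivative [flat 'X^3], which gives convexity. *)
Definition ramp (z : R) := z * flat 1 z.

Lemma is_derive_ramp z : is_derive z (1 : R) ramp (flat (1 + 'X) z).
Proof.
apply: (is_derive_eq (is_deriveM (is_derive_id z 1) (is_derive_flat 1 z))).
rewrite /GRing.scale/= /flat derivC; case: ifPn => [z0|_]; last first.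
  have e (a b : R) : a * 0 + 0 * b = 0 by ring.
  exact: e.
have zz : z != 0 by rewrite gt_eqF.
rewrite !hornerE.
have e (v : R) : z * z^-1 * z^-1 * (1 - 0) * v + v = (1 + z^-1) * v by field.
exact: e.
Qed.

Lemma smooth_ramp : smooth ramp.
Proof.
move=> [//|n]; exists (flat (1 + 'X)); first exact: is_derive_ramp.
exact: smooth_flat.
Qed.

Lemma ramp_le0 z : z <= 0 -> ramp z = 0.
Proof. by move=> z0; rewrite /ramp /flat ltNge z0 mulr0. Qed.

Lemma ramp_ge0 z : 0 <= ramp z.
Proof.
rewrite /ramp /flat; case: ifPn => [z0|_]; last by rewrite mulr0.
by rewrite hornerC mul1r mulr_ge0 ?expR_ge0// ltW.
Qed.

Lemma ramp_ge z : z - 1 <= ramp z.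
Proof.
rewrite /ramp /flat; case: ltP => [z0|z0]; last by rewrite mulr0; lra.
have zz : z != 0 by rewrite gt_eqF.
rewrite hornerC mul1r (_ : z - 1 = z * (1 + (- z^-1))); last by field.
by rewrite ler_wpM2l ?expR_ge1Dx// ltW.
Qed.

Lemma ramp_le z : 0 <= z -> ramp z <= z.
Proof.
rewrite /ramp /flat; case: ifPn => [z0|_ z0]; last by rewrite mulr0.
move=> _; rewrite hornerC mul1r ler_piMr ?ltW//.
by rewrite -[ltRHS]expR0 ltr_expR oppr_lt0 invr_gt0.
Qed.

Lemma flat1X_ge0 z : 0 <= flat (1 + 'X) z.
Proof.
rewrite /flat; case: ifPn => // z0; rewrite !hornerE mulr_ge0 ?expR_ge0//.
by rewrite addr_ge0// invr_ge0 ltW.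
Qed.

Lemma flat1X_le1 z : flat (1 + 'X) z <= 1.
Proof.
rewrite /flat; case: ifPn => // z0; rewrite !hornerE expRN.
by rewrite ler_pdivrMr ?expR_gt0// mul1r expR_ge1Dx.
Qed.

Lemma ramp_le_tangent z : ramp z <= z * flat (1 + 'X) z.
Proof.
rewrite /ramp /flat; case: ifPn => [z0|_]; last by rewrite !mulr0.
rewrite hornerD hornerC hornerX mul1r ler_pM2l// ler_peMl ?expR_ge0//.
by rewrite lerDl invr_ge0 ltW.
Qed.

Lemma is_derive_flat1X z : is_derive z (1 : R) (flat (1 + 'X)) (flat 'X^3 z).
Proof.
apply: (is_derive_eq (is_derive_flat _ _)).
rewrite derivD derivC derivX add0r addrAC subrr add0r.
by rewrite -exprSr.
Qed.

Lemma flatX3_ge0 z : 0 <= flat 'X^3 z.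
Proof.
rewrite /flat; case: ifPn => // z0; rewrite !hornerE mulr_ge0 ?expR_ge0//.
by rewrite exprn_ge0// invr_ge0 ltW.
Qed.

(** The 6 is 3!, from u^3 <= 3! exp u at u = 1/z. *)
Lemma flatX3_le6 z : flat 'X^3 z <= 6.
Proof.
rewrite /flat; case: ifPn => // z0; rewrite !hornerE expRN.
rewrite ler_pdivrMr ?expR_gt0//.
by have := @exprn_le_fact_expR 3 z^-1; apply; rewrite invr_ge0 ltW.
Qed.

End smooth_line.

(** * Smooth functions of the squared norm *)

(** Reduced to the chain rule in one variable: along the line h -> h v + x the difference quotients
    at h = 0 are those of the directional derivative, which is [q]. *)
Lemma is_derive_comp1 (R : realType) (V : normedModType R) (f : R -> R)
    (g : V -> R) (x v : V) (a b : R) :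
  is_derive (g x) (1 : R) f a -> is_derive x v g b ->
  is_derive x v (fun y => f (g y)) (a * b).
Proof.
move=> fa [dg gE].
have q (k : V -> R) : (fun h : R => h^-1 *: ((k \o shift x) (h *: v) - k x)) =
    (fun h : R => h^-1 *: (((fun h : R => k (h *: v + x)) \o shift 0) (h *: 1)
                          - k (0 *: v + x))).
  by apply/funext => h /=; rewrite [h *: 1]mulr1 addr0 scale0r add0r.
have gb : is_derive (0 : R) (1 : R) (fun h : R => g (h *: v + x)) b.
  by apply: DeriveDef; [move: dg|rewrite -gE]; rewrite /derivable /derive q.
have fa0 : is_derive (g (0 *: v + x)) (1 : R) f a by rewrite scale0r add0r.
have [df dfE] := @is_derive1_comp _ f (fun h : R => g (h *: v + x)) 0 a b fa0 gb.
by apply: DeriveDef; [move: df|rewrite -dfE]; rewrite /derivable /derive q.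
Qed.

Section smooth_space.
Variables (R : realType) (d : nat).
Local Notation E := 'rV[R]_d.
Implicit Types (f g : E -> R) (x : E) (i j : 'I_d).
Local Notation basis i := (delta_mx ord0 i : E).

Lemma pderivE i f g : (forall x, is_derive x (basis i) f (g x)) -> pderiv i f = g.
Proof. by move=> fg; apply/funext => x; rewrite /pderiv; exact: derive_val. Qed.

Lemma CkS k f (f' : 'I_d -> E -> R) : continuous f ->
  (forall i x, is_derive x (basis i) f (f' i x)) ->
  (forall i, Ck k (f' i)) -> Ck k.+1 f.
Proof.
move=> cf ff' kf'; split => // i; split; first by move=> x; have [] := ff' i x.
by rewrite (pderivE (ff' i)).
Qed.

Lemma Ck_continuous k f : Ck k f -> continuous f.
Proof. by case: k => [//|k] []. Qed.

Lemma CkW k f : Ck k.+1 f -> Ck k f.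
Proof.
elim: k f => [|k IHk] f [cf kf]; first by [].
by split=> // i; have [df pf] := kf i; split => //; exact: IHk.
Qed.

Lemma Ck_cst k (a : R) : Ck k (cst a : E -> R).
Proof.
elim: k a => [|k IHk] a; first exact: cst_continuous.
have d0 (i : 'I_d) x : is_derive x (basis i) (cst a) 0 by exact: is_derive_cst.
exact: CkS (@cst_continuous _ _ a) d0 (fun=> IHk 0).
Qed.

Lemma CkD k f g : Ck k f -> Ck k g -> Ck k (fun x => f x + g x).
Proof.
elim: k f g => [|k IHk] f g kf kg.
  by move=> x; apply: (@continuousD _ _ _ f g); [exact: (Ck_continuous kf)|exact: (Ck_continuous kg)].
have [[cf pf] [cg pg]] := (kf, kg).
refine (@CkS _ _ (fun i x => pderiv i f x + pderiv i g x) _ _ _).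
- by move=> x; apply: (@continuousD _ _ _ f g); [exact: cf|exact: cg].
- move=> i x; apply: (@is_deriveD _ _ _ f g); apply: derivableP.
    exact: (pf i).1.
  exact: (pg i).1.
- by move=> i; apply: IHk; [exact: (pf i).2|exact: (pg i).2].
Qed.

Lemma CkM k f g : Ck k f -> Ck k g -> Ck k (fun x => f x * g x).
Proof.
elim: k f g => [|k IHk] f g kf kg.
  by move=> x; apply: (@continuousM _ _ f g); [exact: (Ck_continuous kf)|exact: (Ck_continuous kg)].
have [[cf pf] [cg pg]] := (kf, kg).
refine (@CkS _ _ (fun i x => f x * pderiv i g x + g x * pderiv i f x) _ _ _).
- by move=> x; apply: (@continuousM _ _ f g); [exact: cf|exact: cg].
- move=> i x; apply: (@is_deriveM _ _ f g); apply: derivableP.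
    exact: (pf i).1.
  exact: (pg i).1.
- by move=> i; apply: CkD; apply: IHk;
    [exact: CkW|exact: (pg i).2|exact: CkW|exact: (pf i).2].
Qed.

Lemma is_derive_coord i j x :
  is_derive x (basis i) (fun y : E => y ord0 j) (i == j)%:R.
Proof.
have e : (fun h : R => h^-1 *: ((h *: basis i + x) ord0 j - x ord0 j)) @ 0^' -->
    ((i == j)%:R : R).
  apply: cvg_near_cst; near=> h.
  have h0 : h != 0 by near: h; exact: nbhs_dnbhs_neq.
  by rewrite !mxE eqxx eq_sym addrK [_ *: _]mulrA mulVf// mul1r.
apply: DeriveDef; first by apply/cvg_ex; exists (i == j)%:R.
exact/cvg_lim.
Unshelve. all: by end_near. Qed.

Lemma Ck_coord k i : Ck k (fun x : E => x ord0 i).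
Proof.
have c : continuous (fun x : E => x ord0 i) by exact: coord_continuous.
case: k => [//|k].
exact: CkS c (fun j => @is_derive_coord j i) (fun j => @Ck_cst k (j == i)%:R).
Qed.

Definition sqnorm x : R := dot x x.

Lemma continuous_sqnorm : continuous sqnorm.
Proof.
suff H (l : seq 'I_d) : Ck 0 (fun x : E => \sum_(i <- l) x ord0 i * x ord0 i) by exact: H.
elim: l => [|i l IHl].
  rewrite (_ : (fun x => _) = cst 0); first exact: (@Ck_cst 0).
  by apply/funext => x; rewrite big_nil.
under eq_fun do rewrite big_cons.
by apply: (@CkD 0) => //; apply: (@CkM 0); exact: (@Ck_coord 0).
Qed.

Lemma is_derive_sqnorm i x : is_derive x (basis i) sqnorm (2 * x ord0 i).
Proof.
have -> : sqnorm = \sum_(j < d) (fun y : E => y ord0 j * y ord0 j).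
  by apply/funext => y; rewrite fct_sumE.
have H j := is_deriveM (is_derive_coord i j x) (is_derive_coord i j x).
apply: (is_derive_eq (is_derive_sum H)).
rewrite (bigD1 i)//= big1 ?addr0; first by rewrite eqxx [_ *: 1]mulr1 mulr2n mulrDl mul1r.
by move=> j ji; rewrite eq_sym (negbTE ji) [_ *: _]mulr0 addr0.
Qed.

Lemma Ck_comp_sqnorm k (F : R -> R) : smooth F -> Ck k (fun x => F (sqnorm x)).
Proof.
(* One order more than k: [differentiable_times 0] asks nothing, while [Ck 0] asks for
   continuity. *)
move=> smF; have : differentiable_times k.+1 F by exact: smF.
elim: k F {smF} => [|k IHk] F FS.
  have [F' dF _] := FS; move=> x; apply: continuous_comp.
    exact: continuous_sqnorm.
  by apply: differentiable_continuous; apply/derivable1_diffP; have [] := dF (sqnorm x).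
have [F' dF F'S] := FS.
refine (@CkS _ _ (fun i x => F' (sqnorm x) * (2 * x ord0 i)) _ _ _).
- exact/(@Ck_continuous k)/IHk/differentiable_timesW.
- by move=> i x; apply: is_derive_comp1 => //; exact: is_derive_sqnorm.
- move=> i; apply: CkM; first exact: IHk.
  by apply: CkM; [exact: Ck_cst|exact: Ck_coord].
Qed.

Lemma dot_mxact (B : 'M[R]_d) (u v : E) :
  dot (mxact B u) v = \sum_i \sum_j B i j * u ord0 j * v ord0 i.
Proof.
rewrite /dot; apply: eq_bigr => i _; rewrite /mxact mxE mulr_suml.
by apply: eq_bigr => j _; rewrite mxE [u _ _ * _]mulrC.
Qed.

(** Grouped so that F' multiplies the left side of the growth hypothesis without its term in <A x,
    x> / |x|^2, and F'' multiplies <A x, x>. *)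
Lemma operL_comp_sqnorm (A : E -> 'M[R]_d) (G : E -> E) (F F' F'' : R -> R) x :
  (forall r, is_derive r (1 : R) F (F' r)) ->
  (forall r, is_derive r (1 : R) F' (F'' r)) ->
  operL A G (fun y => F (sqnorm y)) x =
  2 * F' (sqnorm x) * (2^-1 * \tr (A x) + dot (G x) x)
  + 2 * F'' (sqnorm x) * dot (mxact (A x) x) x.
Proof.
move=> dF dF'.
have pE i : pderiv i (fun y : E => F (sqnorm y)) =
    (fun y => F' (sqnorm y) * (2 * y ord0 i)).
  apply: pderivE => y; apply: is_derive_comp1 => //; exact: is_derive_sqnorm.
have ppE i j : pderiv i (pderiv j (fun y : E => F (sqnorm y))) =
    (fun y => F'' (sqnorm y) * (2 * y ord0 i) * (2 * y ord0 j)
              + F' (sqnorm y) * (2 * (i == j)%:R)).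
  rewrite pE; apply: pderivE => y.
  have d1 := is_derive_comp1 (dF' (sqnorm y)) (is_derive_sqnorm i y).
  have d2 := is_deriveM (is_derive_cst (2 : R) y (basis i)) (is_derive_coord i j y).
  apply: (is_derive_eq (is_deriveM d1 d2)).
  have e (a b u v : R) : a * (2 * b + v * 0) + 2 * v * u = u * (2 * v) + a * (2 * b).
    ring.
  exact: e.
rewrite /operL; under eq_bigr do under eq_bigr do rewrite ppE mulrDr.
under eq_bigr do rewrite big_split/=.
rewrite big_split/= dot_mxact.
have -> : \sum_i \sum_j A x i j * (F'' (sqnorm x) * (2 * x ord0 i) * (2 * x ord0 j)) =
    4 * F'' (sqnorm x) * \sum_i \sum_j A x i j * x ord0 j * x ord0 i.
  rewrite mulr_sumr; apply: eq_bigr => i _; rewrite mulr_sumr; apply: eq_bigr => j _.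
  ring.
have -> : \sum_i \sum_j A x i j * (F' (sqnorm x) * (2 * (i == j)%:R)) =
    2 * F' (sqnorm x) * \tr (A x).
  rewrite /mxtrace mulr_sumr; apply: eq_bigr => i _.
  rewrite (bigD1 i)//= big1 => [|j ji]; last by rewrite eq_sym (negbTE ji) !mulr0.
  by rewrite eqxx mulr1 addr0 mulrC [F' _ * 2]mulrC.
have -> : dot (G x) (grad (fun y : E => F (sqnorm y)) x) =
    2 * F' (sqnorm x) * dot (G x) x.
  rewrite /dot mulr_sumr; apply: eq_bigr => i _; rewrite mxE pE; ring.
by field.
Qed.

End smooth_space.

(** * The Lyapunov profile *)

Section lyapunov_profile.
Variables (R : realType) (r0 : R).
Implicit Types (r m : R).

(** Here r stands for |x|^2. The value is 1 up to r0 and r + O(1) beyond, so that the logarithm is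
    the eta of the overview; [cutoff m] is then the profile of [f_m]. *)
Definition affine_ramp r := 1 + ramp (r - r0).

Definition log_ramp r := ln (affine_ramp r).

Definition log_ramp1 r := flat (1 + 'X) (r - r0) / affine_ramp r.

Definition log_ramp2 r := flat 'X^3 (r - r0) / affine_ramp r - log_ramp1 r ^+ 2.

Definition cutoff m r := m^-1 * ramp (m - log_ramp r).

Definition cutoff1 m r := - (m^-1 * (flat (1 + 'X) (m - log_ramp r) * log_ramp1 r)).

Definition cutoff2 m r :=
  m^-1 * (flat 'X^3 (m - log_ramp r) * log_ramp1 r ^+ 2
          - flat (1 + 'X) (m - log_ramp r) * log_ramp2 r).

Lemma affine_ramp_ge1 r : 1 <= affine_ramp r.
Proof. by rewrite lerDl ramp_ge0. Qed.

Lemma affine_ramp_gt0 r : 0 < affine_ramp r.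
Proof. exact: lt_le_trans (affine_ramp_ge1 r). Qed.

Lemma affine_ramp_ge r : r - r0 <= affine_ramp r.
Proof. by rewrite /affine_ramp; have := ramp_ge (r - r0); lra. Qed.

Lemma is_derive_affine_ramp r :
  is_derive r (1 : R) affine_ramp (flat (1 + 'X) (r - r0)).
Proof.
have d1 : is_derive r (1 : R) (fun r => r - r0) 1.
  apply: (is_derive_eq (is_deriveD (is_derive_id r 1) (is_derive_cst (- r0) r 1))).
  by rewrite addr0.
have d2 := @is_derive1_comp _ (@ramp R) (fun r => r - r0) r _ _ (is_derive_ramp _) d1.
apply: (is_derive_eq (is_deriveD (is_derive_cst (1 : R) r 1) d2)).
by rewrite mulr1 add0r.
Qed.

Lemma is_derive_log_ramp r : is_derive r (1 : R) log_ramp (log_ramp1 r).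
Proof.
have := @is_derive1_comp _ (@ln R) affine_ramp r _ _
  (is_derive1_ln (affine_ramp_gt0 r)) (is_derive_affine_ramp r).
by move=> H; apply: (is_derive_eq H); rewrite mulrC.
Qed.

Lemma is_derive_log_ramp1 r : is_derive r (1 : R) log_ramp1 (log_ramp2 r).
Proof.
have d1 : is_derive r (1 : R) (fun r => r - r0) 1.
  apply: (is_derive_eq (is_deriveD (is_derive_id r 1) (is_derive_cst (- r0) r 1))).
  by rewrite addr0.
have d2 := @is_derive1_comp _ (flat (1 + 'X)) (fun r => r - r0) r _ _
  (is_derive_flat1X _) d1.
have g0 := lt0r_neq0 (affine_ramp_gt0 r).
have d3 := @is_deriveV _ affine_ramp r _ _ g0 (is_derive_affine_ramp r).
apply: (is_derive_eq (is_deriveM d2 d3)).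
rewrite /log_ramp2 /log_ramp1.
have e (a b g : R) : g != 0 -> a * (- g ^- 2 * a) + g^-1 * (b * 1) = b / g - (a / g) ^+ 2.
  by move=> ?; field.
exact: e.
Qed.

Lemma is_derive_cutoff m r : is_derive r (1 : R) (cutoff m) (cutoff1 m r).
Proof.
have d1 := is_deriveB (is_derive_cst m r 1) (is_derive_log_ramp r).
have d2 := @is_derive1_comp _ (@ramp R) (fun r => m - log_ramp r) r _ _
  (is_derive_ramp _) d1.
apply: (is_derive_eq (is_deriveM (is_derive_cst (m^-1) r 1) d2)).
have e (a b l y : R) : a * (b * (0 - l)) + y * 0 = - (a * (b * l)) by ring.
exact: e.
Qed.

Lemma is_derive_cutoff1 m r : is_derive r (1 : R) (cutoff1 m) (cutoff2 m r).
Proof.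
have d1 := is_deriveB (is_derive_cst m r 1) (is_derive_log_ramp r).
have d2 := @is_derive1_comp _ (flat (1 + 'X)) (fun r => m - log_ramp r) r _ _
  (is_derive_flat1X _) d1.
have d3 := is_deriveM d2 (is_derive_log_ramp1 r).
apply: (is_derive_eq (is_deriveN (is_deriveM (is_derive_cst (m^-1) r 1) d3))).
have e (a b c l k y : R) : - (a * (b * k + l * (c * (0 - l))) + y * 0) =
  a * (c * l ^+ 2 - b * k) by ring.
exact: e.
Qed.

Lemma smooth_cutoff m : smooth (cutoff m).
Proof.
move=> n; apply: differentiable_timesM; first exact: differentiable_times_cst.
have aff a b : differentiable_times n (fun r : R => a + b * r).
  apply: differentiable_timesD; first exact: differentiable_times_cst.
  apply: differentiable_timesM; first exact: differentiable_times_cst.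
  by case: n => // n; exists (fun=> 1); [move=> x; exact: is_derive_id|
    exact: differentiable_times_cst].
apply: (@differentiable_times_comp _ n (@ramp R)); first exact: smooth_ramp.
have -> : (fun r => m - log_ramp r) = (fun r => m + (-1) * log_ramp r).
  by apply/funext => r; rewrite mulN1r.
apply: (@differentiable_times_comp _ n (fun r => m + (-1) * r) log_ramp) => //.
apply: (@differentiable_times_ln _ n affine_ramp); first exact: affine_ramp_gt0.
apply: differentiable_timesD; first exact: differentiable_times_cst.
have -> : (fun r => ramp (r - r0)) = (fun r => ramp (- r0 + 1 * r)).
  by apply/funext => r; rewrite mul1r addrC.
apply: (@differentiable_times_comp _ n (@ramp R)) => //; exact: smooth_ramp.
Qed.

Lemma log_ramp_ge0 r : 0 <= log_ramp r.
Proof. by rewrite ln_ge0// affine_ramp_ge1. Qed.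

Lemma log_ramp_le r : 0 <= r0 -> 0 <= r -> log_ramp r <= r.
Proof.
move=> r00 rge0; apply: le_trans (le_ln1Dx _) _.
  by rewrite (lt_le_trans _ (ramp_ge0 _))// ltrN10.
have [rr0|rr0] := leP r r0; first by rewrite ramp_le0// subr_le0.
by apply: (le_trans (ramp_le _)); lra.
Qed.

Lemma cutoff_ge0 m r : 0 < m -> 0 <= cutoff m r.
Proof. by move=> m0; rewrite mulr_ge0 ?ramp_ge0// invr_ge0 ltW. Qed.

Lemma cutoff_le1 m r : 0 < m -> cutoff m r <= 1.
Proof.
move=> m0; rewrite /cutoff mulrC ler_pdivrMr// mul1r.
have := log_ramp_ge0 r; have [ml L0|ml L0] := leP m (log_ramp r).
  by rewrite ramp_le0 ?subr_le0// ltW.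
by apply: (le_trans (ramp_le _)); lra.
Qed.

(** A crude rate, from [log_ramp r <= r] and [ramp_ge], that still gives convergence to 1 uniformly
    on bounded sets as m grows. *)
Lemma cutoff_ge m r : 0 < m -> 0 <= r0 -> 0 <= r -> 1 - (r + 1) / m <= cutoff m r.
Proof.
move=> m0 r00 rge0; rewrite (_ : 1 - _ = m^-1 * (m - r - 1)); last first.
  by field; rewrite gt_eqF.
rewrite /cutoff ler_pM2l ?invr_gt0//; apply: le_trans (ramp_ge _).
by have := log_ramp_le r00 rge0; lra.
Qed.

Lemma log_ramp_ge m r : r0 + expR m <= r -> m <= log_ramp r.
Proof.
move=> mr; rewrite -[m]expRK ler_ln ?posrE ?expR_gt0 ?affine_ramp_gt0//.
by apply: le_trans (affine_ramp_ge r); lra.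
Qed.

Lemma cutoff_eq0 m r : r0 + expR m <= r ->
  [/\ cutoff m r = 0, cutoff1 m r = 0 & cutoff2 m r = 0].
Proof.
move=> /log_ramp_ge mr.
have m0 p : flat p (m - log_ramp r) = 0 by rewrite /flat subr_gt0 ltNge mr.
rewrite /cutoff /cutoff1 /cutoff2 /ramp !m0 !mul0r subr0 !mulr0 oppr0.
by [].
Qed.

Lemma cutoff12_eq0 m r : r <= r0 -> cutoff1 m r = 0 /\ cutoff2 m r = 0.
Proof.
move=> rr0; have m0 p : flat p (r - r0) = 0 by rewrite /flat subr_gt0 ltNge rr0.
rewrite /cutoff1 /cutoff2 /log_ramp2 /log_ramp1 !m0 !mul0r !expr0n/= !mulr0 !subrr.
by rewrite !mulr0 subr0 mulr0 oppr0.
Qed.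

Lemma log_ramp1_ge0 r : 0 <= log_ramp1 r.
Proof. by rewrite divr_ge0 ?flat1X_ge0// ltW// affine_ramp_gt0. Qed.

Lemma log_ramp1_le1 r : log_ramp1 r <= 1.
Proof.
rewrite /log_ramp1 ler_pdivrMr ?affine_ramp_gt0// mul1r.
exact: le_trans (flat1X_le1 _) (affine_ramp_ge1 r).
Qed.

(** The factor [r * (2^-1 * ln r + 1)] is |x|^2 (ln |x| + 1). Both parts rest on r <= (1 + r0)
    [affine_ramp r]: directly, it bounds [log_ramp1 r * r] by 1 + r0; after taking logarithms, it
    bounds ln r by r0 + [log_ramp r]. Each part costs one power of 1 + r0. *)
Lemma log_ramp_growth r : 1 <= r0 -> r0 < r ->
  log_ramp1 r * (r * (2^-1 * ln r + 1)) <= (1 + r0) ^+ 2 * (1 + log_ramp r).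
Proof.
move=> r01 r0r; have rgt0 : 0 < r by lra.
have rg : r <= (1 + r0) * affine_ramp r.
  have := affine_ramp_ge r; have g1 := affine_ramp_ge1 r.
  have : r0 * 1 <= r0 * affine_ramp r by rewrite ler_wpM2l//; lra.
  by rewrite mulrDl !mul1r; lra.
have l1r : log_ramp1 r * r <= 1 + r0.
  rewrite /log_ramp1 mulrAC ler_pdivrMr ?affine_ramp_gt0//; apply: le_trans rg.
  by rewrite ler_piMl ?flat1X_le1// ltW.
have lnr : ln r <= r0 + log_ramp r.
  apply: (@le_trans _ _ (ln ((1 + r0) * affine_ramp r))).
    by rewrite ler_ln ?posrE// mulr_gt0 ?affine_ramp_gt0//; lra.
  rewrite lnM ?posrE ?affine_ramp_gt0//; last by lra.
  by rewrite lerD2r le_ln1Dx//; lra.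
have L0 := log_ramp_ge0 r.
have lnr0 : 0 <= ln r by rewrite ln_ge0//; lra.
rewrite mulrA expr2 -[(1 + r0) * _ * _]mulrA; apply: ler_pM => //.
- by rewrite mulr_ge0 ?log_ramp1_ge0// ltW.
- by lra.
- have : 0 <= r0 * log_ramp r by rewrite mulr_ge0//; lra.
  by rewrite mulrDl mul1r mulrDr mulr1; lra.
Qed.

Lemma log_ramp2_le r : log_ramp2 r <= 6.
Proof.
rewrite /log_ramp2 lerBlDr (@le_trans _ _ 6)//; last by rewrite lerDl sqr_ge0.
rewrite ler_pdivrMr ?affine_ramp_gt0//.
by have := flatX3_le6 (r - r0); have := affine_ramp_ge1 r; lra.
Qed.

(* [log_ramp] is concave as a function of [ln r] for large [r]. *)
Lemma log_ramp_concave r : 1 <= r0 -> r0 + 4 <= r ->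
  log_ramp1 r / r + log_ramp2 r <= 0.
Proof.
move=> r01 r0r; set x := r - r0; set g := affine_ramp r.
have x4 : 4 <= x by rewrite /x; lra.
have xgt0 : 0 < x by lra.
have rgt0 : 0 < r by lra.
have g0 : 0 < g := affine_ramp_gt0 r.
pose u := x^-1; pose w := expR (- u).
have u0 : 0 < u by rewrite invr_gt0.
have u4 : u <= 4^-1 by rewrite /u lef_pV2// posrE.
have xu : x * u = 1 by rewrite mulfV// gt_eqF.
have w0 : 0 < w := expR_gt0 _.
have wge : 1 - u <= w by exact: expR_ge1Dx.
have wle : w * (1 + u) <= 1.
  rewrite /w expRN mulrC ler_pdivrMr ?expR_gt0// mul1r; exact: expR_ge1Dx.
have gE : g = 1 + x * w.
  by rewrite /g /affine_ramp /ramp /flat -/x xgt0 hornerC mul1r.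
have f1 : flat (1 + 'X) x = w * (1 + u).
  by rewrite /flat xgt0 hornerD hornerC hornerX mulrC.
have f3 : flat 'X^3 x = w * u ^+ 3 by rewrite /flat xgt0 hornerXn mulrC.
rewrite /log_ramp2 /log_ramp1 -/x -/g f1 f3.
have -> : w * (1 + u) / g / r + (w * u ^+ 3 / g - (w * (1 + u) / g) ^+ 2) =
    w / g ^+ 2 * ((1 + u) * g / r + u ^+ 3 * g - w * (1 + u) ^+ 2).
  by field; rewrite !gt_eqF.
rewrite pmulr_rle0; last by rewrite divr_gt0// exprn_gt0.
have gle : g <= x * (1 + u ^+ 2).
  (* Multiplying by 1 + u makes the bound w (1 + u) <= 1 applicable to g = 1 + x w. *)
  rewrite -(ler_pM2r (_ : 0 < 1 + u)); last by lra.
  have -> : x * (1 + u ^+ 2) * (1 + u) = x + x * u + x * u * u * (1 + u).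
    by ring.
  rewrite gE xu mul1r mulrDl mul1r -mulrA.
  have : x * (w * (1 + u)) <= x * 1 by rewrite ler_pM2l.
  by have := mulr_gt0 u0 u0; rewrite mulrDr !mulr1; lra.
have a1 : (1 + u) * g / r <= 1 + u ^+ 2.
  rewrite ler_pdivrMr//; apply: (@le_trans _ _ ((1 + u) * (x * (1 + u ^+ 2)))).
    by rewrite ler_pM2l//; lra.
  rewrite mulrA [leRHS]mulrC ler_wpM2r ?addr_ge0 ?sqr_ge0//.
  by rewrite mulrDl mul1r mulrC xu /x; lra.
have a2 : u ^+ 3 * g <= u ^+ 2 * (1 + u ^+ 2).
  apply: (@le_trans _ _ (u ^+ 3 * (x * (1 + u ^+ 2)))).
    by rewrite ler_pM2l// exprn_gt0.
  by rewrite exprSr mulrA -[u ^+ 2 * u * x]mulrA [u * x]mulrC xu mulr1.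
have a3 : (1 - u) * (1 + u) ^+ 2 <= w * (1 + u) ^+ 2.
  by rewrite ler_pM2r// exprn_gt0//; lra.
(* What is left is 3 u^2 + u^3 + u^4 <= u, which holds for u <= 1/4; this is the origin of the 4 in
   r0 + 4. *)
have u2 : u ^+ 2 <= u * 4^-1 by rewrite expr2 ler_pM2l.
have u3 : u ^+ 3 <= u * 16^-1.
  rewrite exprS ler_pM2l// (le_trans u2)//; lra.
have u4' : u ^+ 2 * u ^+ 2 <= u * 64^-1.
  rewrite (_ : _ * _ = u * u ^+ 3); last by ring.
  rewrite ler_pM2l// (le_trans u3)//; lra.
have e3 : (1 - u) * (1 + u) ^+ 2 = 1 + u - u ^+ 2 - u ^+ 3 by ring.
have e2 : u ^+ 2 * (1 + u ^+ 2) = u ^+ 2 + u ^+ 2 * u ^+ 2 by ring.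
lra.
Qed.

(* [S] stands for [tr A / 2 + <G, x>] and [Q] for [<A x, x>] at a point with
   [|x|^2 = r]. The convexity of [ramp] gives [ramp y <= y * ramp' y], which
   absorbs the growth of order [log_ramp r] of the first order term. *)
Lemma cutoff_lyapunov m r K alpha S Q q :
  1 <= r0 -> 0 < m -> 0 <= K -> 2 * K * (1 + r0) ^+ 2 <= alpha -> 0 <= q ->
  0 <= Q -> (r < r0 + 4 -> Q <= q) -> r0 < r ->
  S <= K * (r * (2^-1 * ln r + 1)) + Q / r ->
  alpha * cutoff m r - (2 * cutoff1 m r * S + 2 * cutoff2 m r * Q) <=
  alpha + (alpha + 14 * q) / m.
Proof.
move=> r01 m0 K0 Kalpha q0 Q0 Qq r0r Sle.
have rgt0 : 0 < r by lra.
set L := log_ramp r; have L0 : 0 <= L := log_ramp_ge0 r.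
set l1 := log_ramp1 r; set l2 := log_ramp2 r.
set e1 := flat (1 + 'X) (m - L); set e3 := flat 'X^3 (m - L).
have e10 : 0 <= e1 := flat1X_ge0 _.
have e11 : e1 <= 1 := flat1X_le1 _.
have e30 : 0 <= e3 := flatX3_ge0 _.
have l10 : 0 <= l1 := log_ramp1_ge0 r.
have alpha0 : 0 <= alpha.
  by apply: le_trans Kalpha; rewrite mulr_ge0 ?sqr_ge0// mulr_ge0.
have mV0 : 0 < m^-1 by rewrite invr_gt0.
have c1 : cutoff1 m r = - (m^-1 * (e1 * l1)) by [].
have c2 : cutoff2 m r = m^-1 * (e3 * l1 ^+ 2 - e1 * l2) by [].
have c0 : cutoff m r <= m^-1 * (e1 * (m - L)).
  by rewrite /cutoff ler_pM2l// mulrC; exact: ramp_le_tangent.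
have first : e1 * l1 * S <=
    e1 * (K * ((1 + r0) ^+ 2 * (1 + L))) + e1 * (l1 * (Q / r)).
  rewrite -mulrA -mulrDr ler_wpM2l//.
  apply: le_trans (ler_wpM2l l10 Sle) _.
  rewrite mulrDr lerD2r mulrCA ler_wpM2l//; exact: log_ramp_growth.
(* Beyond r0 + 4 the factor is nonpositive, however large Q is. In the transition zone Q <= q, and 7
   = 1 + 6 bounds l1 / r + l2. *)
have second : e1 * (l1 / r + l2) * Q <= 7 * q.
  have [rr4|rr4] := ltP r (r0 + 4); last first.
    apply: (@le_trans _ _ 0); last by rewrite mulr_ge0.
    by rewrite -mulrA mulr_ge0_le0// mulr_le0_ge0// log_ramp_concave.
  have l17 : l1 / r + l2 <= 7.
    have : l1 / r <= 1.
      by rewrite ler_pdivrMr// mul1r (le_trans (log_ramp1_le1 r))//; lra.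
    by have : l2 <= 6 := log_ramp2_le r; lra.
  apply: (@le_trans _ _ (7 * Q)); last by have := Qq rr4; lra.
  rewrite ler_wpM2r//; apply: (@le_trans _ _ (e1 * 7)); last by lra.
  by rewrite ler_wpM2l.
have third : 0 <= e3 * l1 ^+ 2 * Q by rewrite mulr_ge0// mulr_ge0// sqr_ge0.
have fourth : 2 * (e1 * (K * ((1 + r0) ^+ 2 * (1 + L)))) <= alpha * (e1 * (1 + L)).
  have -> : 2 * (e1 * (K * ((1 + r0) ^+ 2 * (1 + L)))) =
    2 * K * (1 + r0) ^+ 2 * (e1 * (1 + L)) by ring.
  by rewrite ler_wpM2r// mulr_ge0// addr_ge0.
(* The tangent bound contributes alpha e1 (m - L) and the drift alpha e1 (1 + L), so L cancels; 14
   is twice the 7 of [second]. The term in e3 has a favourable sign and is dropped. *)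
apply: (@le_trans _ _ (m^-1 * (alpha * (e1 * (m + 1)) + 14 * q))); last first.
  have -> : alpha + (alpha + 14 * q) / m = m^-1 * (alpha * (m + 1) + 14 * q).
    by field; rewrite gt_eqF.
  rewrite ler_pM2l// lerD2r ler_wpM2l//.
  have : e1 * (m + 1) <= 1 * (m + 1) by rewrite ler_wpM2r//; lra.
  by rewrite mul1r.
have ac0 := ler_wpM2l alpha0 c0.
rewrite c1 c2.
have -> : 2 * - (m^-1 * (e1 * l1)) * S + 2 * (m^-1 * (e3 * l1 ^+ 2 - e1 * l2)) * Q =
  m^-1 * (- (2 * (e1 * l1 * S)) + 2 * (e3 * l1 ^+ 2 * Q) - 2 * (e1 * l2 * Q)).
  by ring.
apply: (@le_trans _ _ (m^-1 * (alpha * (e1 * (m - L))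
   - (- (2 * (e1 * l1 * S)) + 2 * (e3 * l1 ^+ 2 * Q) - 2 * (e1 * l2 * Q))))).
  by rewrite [leRHS]mulrBr lerD2r [leRHS]mulrCA.
rewrite ler_pM2l//.
have s2 : e1 * (l1 * (Q / r)) + e1 * l2 * Q <= 7 * q.
  by apply: le_trans second; rewrite le_eqVlt; apply/orP; left; apply/eqP; ring.
have s5 : alpha * (e1 * (m - L)) + alpha * (e1 * (1 + L)) = alpha * (e1 * (m + 1)).
  by ring.
lra.
Qed.

End lyapunov_profile.

(** * The Lyapunov inequality for L on the cutoff functions *)

Section lyapunov_test_functions.
Variables (R : realType) (d : nat).
Local Notation E := 'rV[R]_d.
Implicit Types (x : E) (c : R).

Lemma dot_self_ge0 x : 0 <= dot x x.
Proof. by apply: sumr_ge0 => i _; rewrite -expr2 sqr_ge0. Qed.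

Lemma enorm_sqr x : enorm x ^+ 2 = sqnorm x.
Proof. by rewrite sqr_sqrtr// dot_self_ge0. Qed.

Lemma closed_sqnorm_ball c : closed [set x : E | sqnorm x <= c].
Proof.
apply: (@closed_comp _ _ (@sqnorm R d) [set r | r <= c]); last exact: closed_le.
by move=> x _; exact: continuous_sqnorm.
Qed.

Lemma open_sqnorm_ball c : open [set x : E | sqnorm x < c].
Proof.
apply: (@open_comp _ _ (@sqnorm R d) [set r | r < c]); last exact: open_lt.
by move=> x _; exact: continuous_sqnorm.
Qed.

Lemma compact_sqnorm_ball c : compact [set x : E | sqnorm x <= c].
Proof.
(* The half-side c + 1 replaces the square root of c: v_i^2 <= c <= (c + 1)^2 when c >= 0. *)
have boxc : compact [set v : E | forall i, v ord0 i \in `[- (c + 1), c + 1]].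
  apply: (@rV_compact _ _ (fun=> `[- (c + 1), c + 1]%classic)) => i.
  exact: segment_compact.
apply: (subclosed_compact (@closed_sqnorm_ball c) boxc) => v /= vc i.
have vi : v ord0 i ^+ 2 <= c.
  apply: le_trans vc; rewrite /sqnorm /dot (bigD1 i)//= -expr2 lerDl.
  by apply: sumr_ge0 => j _; rewrite -expr2 sqr_ge0.
have c0 : 0 <= c by apply: le_trans vi; rewrite sqr_ge0.
rewrite in_itv/= -ler_norml -(ler_pXn2r (_ : (0 < 2)%N)) ?nnegrE ?addr_ge0//.
rewrite real_normK ?num_real//; apply: (le_trans vi).
rewrite sqrrD1; have := sqr_ge0 c; lra.
Qed.

Lemma relatively_compact_sqnorm_ball c (V : set E) :
  V `<=` [set x : E | sqnorm x <= c] -> relatively_compact V.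
Proof.
move=> Vc; rewrite /relatively_compact.
apply: (subclosed_compact _ (@compact_sqnorm_ball c)); first exact: closed_closure.
have /closure_id -> := @closed_sqnorm_ball c.
exact: closure_subset.
Qed.

Lemma test_fun_cutoff (r0 m : R) :
  test_fun setT (fun x : E => cutoff r0 m (sqnorm x)).
Proof.
split => //; first by move=> k; apply: Ck_comp_sqnorm; exact: smooth_cutoff.
apply: (@relatively_compact_sqnorm_ball (r0 + expR m)) => x /= fx.
rewrite leNgt; apply/negP => /ltW /cutoff_eq0[f0 _ _].
by move: fx; rewrite f0 eqxx.
Qed.

Lemma ln_enorm x : 0 < sqnorm x -> ln (enorm x) = 2^-1 * ln (sqnorm x).
Proof.
move=> x0; have -> : ln (sqnorm x) = 2 * ln (enorm x).
  by rewrite -enorm_sqr lnXn ?sqrtr_gt0// mulr_natl.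
by rewrite mulrA mulVf ?mul1r// pnatr_eq0.
Qed.

Lemma elliptic_locally_bounded (p : R) (A C : E -> 'M[R]_d) (H : E -> E) c :
  assumption_a p A C H ->
  exists2 q, 0 <= q & forall x, sqnorm x <= c -> 0 <= dot (mxact (A x) x) x <= q.
Proof.
move=> aA.
have [nu nu0 nuP] := A_elliptic aA (@relatively_compact_sqnorm_ball c _ (@subset_refl _ _)).
exists (nu * `|c|); first by rewrite mulr_ge0// ltW.
move=> x xc; have := nuP x x xc; rewrite enorm_sqr => /andP[l u].
rewrite (le_trans _ l)/=; last by rewrite mulr_ge0 ?invr_ge0 ?dot_self_ge0// ltW.
apply: (le_trans u); rewrite ler_pM2l//; exact: le_trans xc (ler_norm c).
Qed.

(** The growth bound is assumed at the single point x, so that the a.e. version follows by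
    filtering. The indicator is allowed because the cutoff and its image under L vanish off the
    ball; it keeps the error term integrable even if mu is infinite. *)
Lemma cutoff_lyapunov_operator (p : R) (A C : E -> 'M[R]_d) (H : E -> E)
    (K : R) (N0 : nat) :
  assumption_a p A C H -> 0 < K ->
  exists r0 alpha q : R, [/\ 0 <= r0, 0 < alpha, 0 <= q &
    forall m x, 0 < m ->
    (N0%:R < enorm x ->
      - (dot (mxact (A x) x) x / enorm x ^+ 2) + 2^-1 * \tr (A x)
        + dot (driftG A C H x) x
      <= K * enorm x ^+ 2 * (ln (enorm x) + 1)) ->
    alpha * cutoff r0 m (sqnorm x)
    - (alpha + q / m) * \1_[set y | sqnorm y < r0 + expR m] x <=
    operL A (driftG A C H) (fun y => cutoff r0 m (sqnorm y)) x].
Proof.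
(* Then |x|^2 > r0 forces |x| > N0, and r0 >= 1 as [cutoff_lyapunov] requires. *)
move=> aA K0; pose r0 : R := N0%:R ^+ 2 + 1.
have r01 : 1 <= r0 by rewrite lerDr sqr_ge0.
pose alpha := 2 * K * (1 + r0) ^+ 2.
have alpha0 : 0 < alpha.
  by apply: mulr_gt0; [exact: mulr_gt0|apply: exprn_gt0; lra].
have [q q0 qP] := elliptic_locally_bounded (r0 + 4) aA.
exists r0, alpha, (alpha + 14 * q); split => //; first by lra.
  by apply: addr_ge0; [exact: ltW|exact: mulr_ge0].
move=> m x m0 xP.
rewrite (operL_comp_sqnorm _ _ _ (is_derive_cutoff r0 m) (is_derive_cutoff1 r0 m)).
have aq0 : 0 <= (alpha + 14 * q) / m.
  by apply: divr_ge0 (ltW m0); apply: addr_ge0; [exact: ltW|exact: mulr_ge0].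
have [xl|xl] := leP (r0 + expR m) (sqnorm x).
  have [-> -> ->] := cutoff_eq0 xl.
  rewrite indicE memNset ?mulr0; last by rewrite /= ltNge xl.
  by rewrite !mul0r subr0 addr0.
rewrite indicE mem_set// mulr1 lerBlDr -lerBlDl.
have [xr|xr] := leP (sqnorm x) r0.
  have [-> ->] := cutoff12_eq0 m xr; rewrite !mulr0 !mul0r addr0 subr0.
  apply: (@le_trans _ _ (alpha * 1)); first by rewrite ler_pM2l// cutoff_le1.
  by rewrite mulr1 lerDl.
have sx0 : 0 < sqnorm x by lra.
have Q0 : 0 <= dot (mxact (A x) x) x.
  have [_ _ /(_ x (lexx _))/andP[]//] := elliptic_locally_bounded (sqnorm x) aA.
have := xP _; rewrite enorm_sqr ln_enorm// => {}xP.
apply: (cutoff_lyapunov r01 m0 (ltW K0) (lexx _) q0 Q0 _ xr).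
  by move=> /ltW /qP /andP[].
have N0x : N0%:R < enorm x.
  rewrite -(ltr_pXn2r (_ : (0 < 2)%N)) ?nnegrE ?sqrtr_ge0// enorm_sqr.
  by rewrite /r0 in xr; lra.
have := xP N0x; rewrite -addrA addrC lerBlDr mulrA.
by [].
Qed.

End lyapunov_test_functions.

(** * Lebesgue measure and the invariant measure *)

Section full_support.
Variable R : realType.
Local Notation tupleR n := (n.-tuple (measurableTypeR R)).

Definition tuple_box n (x : tupleR n) (e : R) : set (tupleR n) :=
  [set t | forall i, `|tnth x i - tnth t i : R| < e].

Lemma measurable_tuple_box n (x : tupleR n) (e : R) : measurable (tuple_box x e).
Proof.
have -> : tuple_box x e = \bigcap_(i in [set: 'I_n])
    ((@tnth n (measurableTypeR R))^~ i @^-1` [set y : measurableTypeR R | `|tnth x i - y : R| < e]).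
  by apply/seteqP; split => [t tx i _|t tx i]; [exact: tx|exact: (tx i I)].
apply: fin_bigcap_measurable => [|i _]; first exact: finite_finset.
rewrite -[X in measurable X]setTI; apply: measurable_tnth => //.
exact: (measurable_ball (tnth x i : R) e).
Qed.

Lemma lebesgue_tuple_box_gt0 n (x : tupleR n) (e : R) : 0 < e ->
  (0 < lebesgue_tuple R n (tuple_box x e))%E.
Proof.
move=> e0; elim: n x => [|n IHn] x.
  by rewrite /= diracE mem_set ?lte01// => -[].
case/tupleP: x => x0 x.
have boxE : @consT R n @^-1` tuple_box [tuple of x0 :: x] e =
    ball (x0 : R) e `*` tuple_box x e.
  apply/seteqP; split => [[z t] /= zt|[z t] /= [zx tx] i].
    split; first by have := zt ord0; rewrite !tnth0.
    by move=> i; have := zt (lift ord0 i); rewrite !tnthS.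
  case: (unliftP ord0 i) => [j|] ->; first by rewrite !tnthS; exact: tx.
  by rewrite !tnth0; exact: zx.
change (0 < (@lebesgue_measure R \x lebesgue_tuple R n)%E
  (@consT R n @^-1` tuple_box [tuple of x0 :: x] e))%E.
rewrite boxE product_measure1E//; last first.
- exact: measurable_tuple_box.
- exact: measurable_ball.
apply: mule_gt0; last exact: IHn.
have /(congr1 (fun y => (0 < y)%E)) := @lebesgue_measure_ball R x0 e (ltW e0).
by rewrite lte_fin mulrn_wgt0// => bE; exact: bE.
Qed.

Variable d : nat.
Local Notation E := 'rV[R]_d.

Lemma measurable_open_rV (U : set E) : open U -> measurable U.
Proof. by move=> oU; exact: sub_sigma_algebra. Qed.

Lemma lebesgue_rV_open_gt0 (U : set E) : open U -> U !=set0 ->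
  (0 < @lebesgue_rV R d U)%E.
Proof.
move=> oU [x Ux].
have /nbhs_ballP[e /= e0 eP] : nbhs x U by exact: open_nbhs_nbhs.
rewrite /lebesgue_rV /pushforward.
apply: (lt_le_trans (lebesgue_tuple_box_gt0 [tuple x ord0 i | i < d] e0)).
apply: le_measure; rewrite ?inE.
- exact: measurable_tuple_box.
- rewrite -[X in measurable X]setTI; apply: measurable_row_of_tuple => //.
  exact: measurable_open_rV.
move=> t tx /=; apply: eP; split => // i j.
have := tx j; rewrite tnth_mktuple => txj.
by rewrite ord1 /row_of_tuple mxE; exact: txj.
Qed.

End full_support.

Section density.
Variables (R : realType) (d : nat).
Local Notation E := 'rV[R]_d.
Local Notation leb := (@lebesgue_rV R d).
Variables (p : R) (A : E -> 'M[R]_d) (G : E -> E) (rho : E -> R).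
Variable mu : {measure set E -> \bar R}.
Hypothesis rhomu : invariant_density p A G rho mu.

Lemma density_measurable : measurable_fun setT rho.
Proof. by have [[]] := rho_H1loc rhomu. Qed.

(** Carries the growth condition, given Lebesgue-a.e., over to mu, in terms of which the semigroup
    is described. *)
Lemma density_ae (Q : E -> Prop) :
  {ae leb, forall x, Q x} -> {ae mu, forall x, Q x}.
Proof.
move=> [N [mN N0 QN]]; exists N; split => //.
rewrite (mu_density rhomu)//.
rewrite (eq_integral (fun x => `|(rho x)%:E|)%E); last first.
  by move=> x _; rewrite gee0_abs// lee_fin ltW// (rho_gt0 rhomu).
apply: integral_abs_eq0 => //; apply/measurable_EFinP.
by apply: measurable_funTS; exact: density_measurable.
Qed.

(** If mu U were 0, rho would vanish almost everywhere on U; since rho > 0, U would be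
    Lebesgue-null, which a nonempty open set is not. *)
Lemma density_open_gt0 (U : set E) : open U -> U !=set0 -> (0 < mu U)%E.
Proof.
move=> oU U0; have mU := measurable_open_rV oU.
have mrho : measurable_fun U (EFin \o rho).
  by apply/measurable_EFinP; apply: measurable_funTS; exact: density_measurable.
rewrite lt0e measure_ge0 andbT; apply/negP => /eqP.
rewrite (mu_density rhomu)// (eq_integral (fun x => `|(EFin \o rho) x|)%E); last first.
  by move=> x _; rewrite gee0_abs// lee_fin ltW// (rho_gt0 rhomu).
move/(ae_eq_integral_abs leb mU mrho) => [N [mN N0 UN]].
have := lebesgue_rV_open_gt0 oU U0; apply/negP; rewrite -leNgt -N0.
apply: le_measure; rewrite ?inE// => x Ux; apply: UN => /= /(_ Ux) [rx].
by have := rho_gt0 rhomu x; rewrite rx ltxx.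
Qed.

End density.

(** * Mass under the semigroup *)

Section integral_functionals.
Variables (R : realType) (d : nat).
Local Notation E := 'rV[R]_d.
Variable mu : {measure set E -> \bar R}.
Implicit Types (f g u v w : E -> R) (D : set E).

Local Notation L1 f := (mu.-integrable setT (EFin \o f)).
Local Notation norm1 f := (\int[mu]_x `|f x|)%R.

Lemma Lp_onT f : L1 f -> Lp_on mu setT 1 f.
Proof. by move=> fL; split; [exact/Lfun1_integrable|move=> x /(_ I)]. Qed.

Lemma Lp_onT_integrable f : Lp_on mu setT 1 f -> L1 f.
Proof. by move=> [/Lfun1_integrable]. Qed.

Lemma L1D f g : L1 f -> L1 g -> L1 (fun x => f x + g x).
Proof. by move=> fL gL; apply: (integrableD measurableT fL gL). Qed.

Lemma L1Z a f : L1 f -> L1 (fun x => a * f x).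
Proof. by move=> fL; apply: (integrableZl measurableT a fL). Qed.

Lemma L1B f g : L1 f -> L1 g -> L1 (fun x => f x - g x).
Proof. by move=> fL gL; apply: (integrableB measurableT fL gL). Qed.

Lemma L1_on D f : measurable D -> L1 f -> mu.-integrable D (EFin \o f).
Proof. by move=> mD; apply: integrableS. Qed.

Lemma L1_indic D : measurable D -> (mu D < +oo)%E -> L1 (\1_D : E -> R).
Proof.
move=> mD muD; apply/integrableP; split.
  by apply/measurable_EFinP; exact: measurable_indic.
rewrite (eq_integral (fun x => (\1_D x)%:E)); last first.
  by move=> x _; rewrite gee0_abs// lee_fin.
by rewrite integral_indic// setIT.
Qed.

Lemma integrable_cst_on D a : measurable D -> (mu D < +oo)%E ->
  mu.-integrable D (EFin \o (cst a : E -> R)).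
Proof.
move=> mD muD; apply/integrableP; split; first exact/measurable_EFinP.
rewrite (eq_integral (cst `|a|%:E)); last by [].
by rewrite integral_cst// lte_mul_pinfty.
Qed.

Lemma Lnorm1_norm1 f : L1 f -> ('N[mu]_1 [EFin \o f] = (norm1 f)%:E)%E.
Proof.
move=> fL; rewrite Lnorm1 /Rintegral fineK//.
have := integrable_fin_num measurableT (integrable_norm fL).
by [].
Qed.

Lemma Rintegral_ae_ge0 D f : measurable D -> mu.-integrable D (EFin \o f) ->
  {ae mu, forall x, 0 <= f x} -> 0 <= \int[mu]_(x in D) f x.
Proof.
move=> mD fL f0.
rewrite (_ : Rintegral _ _ _ = \int[mu]_(x in D) `|f x|).
  by apply: Rintegral_ge0 => x _; exact: normr_ge0.
congr fine; apply: ae_eq_integral => //.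
- by have /integrableP[] := fL.
- by have /integrableP[] := integrable_norm fL.
- by apply: filterS f0 => x f0 _ /=; rewrite ger0_norm.
Qed.

(** Common abstraction of the integral over D of f and of [T t f], with c the mass of D. One
    Gronwall step then covers time 0, where T is not specified, together with all positive times. *)
Record sub_probability_functional (J : (E -> R) -> R) (c : R) : Prop := {
  functional_linear : forall a f g, L1 f -> L1 g ->
    J (fun x => a * f x + g x) = a * J f + J g ;
  functional_norm : forall f, L1 f -> `|J f| <= norm1 f ;
  functional_ge0 : forall f, L1 f -> {ae mu, forall x, 0 <= f x} -> 0 <= J f ;
  functional_indic : forall B, measurable B -> (mu B < +oo)%E -> J \1_B <= c }.

Lemma functionalB J c f g : sub_probability_functional J c -> L1 f -> L1 g ->
  J (fun x => f x - g x) = J f - J g.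
Proof.
move=> JP fL gL.
have -> : (fun x => f x - g x) = (fun x => (-1) * g x + f x).
  by apply/funext => x; rewrite mulN1r addrC.
by rewrite (functional_linear JP)// mulN1r addrC.
Qed.

Lemma functional_le J c f g : sub_probability_functional J c -> L1 f -> L1 g ->
  {ae mu, forall x, f x <= g x} -> J f <= J g.
Proof.
move=> JP fL gL fg; rewrite -subr_ge0 -(functionalB JP)//.
apply: (functional_ge0 JP); first exact: L1B.
by apply: filterS fg => x; rewrite subr_ge0.
Qed.

Lemma norm1_on_le D f : measurable D -> L1 f ->
  `|\int[mu]_(x in D) f x| <= norm1 f.
Proof.
move=> mD fL; apply: le_trans (le_normr_Rintegral mD (L1_on mD fL)) _.
have nL := integrable_norm fL.
apply: fine_le.
- exact: (integrable_fin_num mD (L1_on mD nL)).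
- exact: (integrable_fin_num measurableT nL).
- by apply: ge0_subset_integral => //; have /integrableP[] := nL.
Qed.

Lemma integral_functional D : measurable D -> (mu D < +oo)%E ->
  sub_probability_functional (fun f => \int[mu]_(x in D) f x) (fine (mu D)).
Proof.
move=> mD muD; split => [a f g fL gL|f fL|f fL f0|B mB muB].
- rewrite RintegralD ?RintegralZl//;
    by apply: L1_on => //; exact: L1Z.
- exact: norm1_on_le.
- by apply: Rintegral_ae_ge0 => //; exact: L1_on.
- rewrite /Rintegral integral_indic//; apply: fine_le.
  + rewrite ge0_fin_numE//; apply: le_lt_trans muD.
    by apply: le_measure; rewrite ?inE//; exact: measurableI.
  + by rewrite ge0_fin_numE.
  + by apply: le_measure; rewrite ?inE//; exact: measurableI.
Qed.

(** * Integrals of the semigroup over a measurable set *)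

Section semigroup.
Variable T : R -> (E -> R) -> (E -> R).
Hypothesis TP : sub_markovian_C0_contraction_semigroup mu setT T.

Lemma semigroup_L1 t f : 0 < t -> L1 f -> L1 (T t f).
Proof.
by move=> t0 fL; apply/Lp_onT_integrable/(sg_L1 TP) => //; exact: Lp_onT.
Qed.

Lemma semigroup_norm1 t f : 0 < t -> L1 f -> norm1 (T t f) <= norm1 f.
Proof.
move=> t0 fL; rewrite -lee_fin -!Lnorm1_norm1//; last exact: semigroup_L1.
by apply: (sg_contraction TP) => //; exact: Lp_onT.
Qed.

Lemma eq_ae_Rintegral D f g : measurable D -> L1 f -> L1 g ->
  f = g %[ae mu] -> \int[mu]_(x in D) f x = \int[mu]_(x in D) g x.
Proof.
move=> mD fL gL fg; congr fine; apply: ae_eq_integral => //.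
- by have /integrableP[] := L1_on mD fL.
- by have /integrableP[] := L1_on mD gL.
- by apply: filterS fg => x fg _ /=; rewrite fg.
Qed.

Lemma semigroup_linear D t a f g : measurable D -> 0 < t -> L1 f -> L1 g ->
  \int[mu]_(x in D) T t (fun x => a * f x + g x) x =
  a * (\int[mu]_(x in D) T t f x) + \int[mu]_(x in D) T t g x.
Proof.
move=> mD t0 fL gL.
have TfL := semigroup_L1 t0 fL; have TgL := semigroup_L1 t0 gL.
rewrite -RintegralZl//; last exact: L1_on.
rewrite -RintegralD//; last 2 first.
- by apply: L1_on => //; exact: L1Z.
- exact: L1_on.
apply: eq_ae_Rintegral => //.
- by apply: semigroup_L1 => //; apply: L1D => //; exact: L1Z.
- by apply: L1D => //; exact: L1Z.
- exact: (sg_linear TP a t0 (Lp_onT fL) (Lp_onT gL)).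
Qed.

(* Sub-Markovianity only concerns functions with values in [0, 1]; a
   nonnegative L^1 function is the L^1 limit of its truncations at level n. *)
Lemma semigroup_ge0 D t f : measurable D -> 0 < t -> L1 f ->
  {ae mu, forall x, 0 <= f x} -> 0 <= \int[mu]_(x in D) T t f x.
Proof.
move=> mD t0 fL f0.
pose v n x := Num.min (Num.max (f x) 0) n.+1%:R.
have mf : measurable_fun setT f by have /integrableP[/measurable_EFinP] := fL.
have mv n : measurable_fun setT (v n).
  apply: measurable_minr; last exact: measurable_cst.
  apply: measurable_maxr => //; exact: measurable_cst.
have v0 n x : 0 <= v n x by rewrite /v le_min ler0n le_max lexx orbT.
have vn n x : v n x <= n.+1%:R by rewrite /v ge_min lexx orbT.
have vf n x : `|v n x| <= `|f x|.
  rewrite ger0_norm// /v ge_min; apply/orP; left.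
  by rewrite ge_max normr_ge0 ler_norm.
have vL n : L1 (v n).
  apply: (le_integrable measurableT _ _ fL).
  - exact/measurable_EFinP.
  - by move=> x _ /=; rewrite lee_fin.
have Tv0 n : 0 <= \int[mu]_(x in D) T t (v n) x.
  (* Dividing by n + 1 brings [v n] into [0, 1], where sub-Markovianity applies. *)
  have u1 : L1 (fun x => n.+1%:R^-1 * v n x) by exact: L1Z.
  have z : L1 (fun=> 0 : R) by exact: integrable0.
  have vE : v n = (fun x => n.+1%:R * (n.+1%:R^-1 * v n x) + 0).
    by apply/funext => x; rewrite addr0 mulrA divff ?mul1r// pnatr_eq0.
  (* In this shape linearity says that the value at 0 equals minus itself plus itself, hence is
     0. *)
  have zE : (fun=> 0 : R) = (fun x : E => (-1) * 0 + 0).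
    by apply/funext => x; rewrite mulr0 addr0.
  have T0 : \int[mu]_(x in D) T t (fun=> 0) x = 0.
    rewrite {1}zE (semigroup_linear _ mD t0 z z); ring.
  rewrite vE (semigroup_linear _ mD t0 u1 z) T0 addr0 mulr_ge0//.
  apply: Rintegral_ae_ge0 => //; first by apply: L1_on => //; exact: semigroup_L1.
  have : {ae mu, forall x, 0 <= n.+1%:R^-1 * v n x <= 1}.
    apply: aeW => x; rewrite mulr_ge0//=.
    by rewrite mulrC ler_pdivrMr ?ltr0n// mul1r.
  move/(sg_sub_markovian TP t0 (Lp_onT u1)).
  by apply: filterS => x /andP[].
have vcvg : (\int[mu]_x `|(v n x)%:E - (f x)%:E|)%E @[n --> \oo] --> 0%E.
  have [//|||||_ +_] := @dominated_convergence _ _ _ mu setT measurableT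
    (fun n => EFin \o v n) (EFin \o f) (fun x => `|f x|%:E).
  - by move=> n; exact/measurable_EFinP.
  - exact/measurable_EFinP.
  - apply: filterS f0 => x f0 _; apply: cvg_EFin; first exact: nearW.
    apply: cvg_near_cst; near=> n; rewrite /= /v (max_idPl f0).
    apply/min_idPl; apply: (@le_trans _ _ n%:R); last by rewrite ler_nat.
    by near: n; exact: nbhs_infty_ger.
  - exact: integrable_norm.
  - by apply: aeW => x n _ /=; rewrite lee_fin.
  - exact.
(* Split f as (f - v n) + v n: the second part contributes a nonnegative amount, the first at least
   minus its L^1 norm by contraction. *)
have low n : - fine (\int[mu]_x `|(v n x)%:E - (f x)%:E|)%E <= \int[mu]_(x in D) T t f x.
  have dL : L1 (fun x => f x - v n x) by exact: L1B.
  have dE : f = (fun x => 1 * (f x - v n x) + v n x).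
    by apply/funext => x; rewrite mul1r subrK.
  rewrite [in leRHS]dE (semigroup_linear _ mD t0 dL (vL n)) mul1r.
  apply: (@le_trans _ _ (\int[mu]_(x in D) T t (fun x => f x - v n x) x)); last first.
    by rewrite lerDl.
  rewrite lerNl; apply: (@le_trans _ _ `|\int[mu]_(x in D) T t (fun x => f x - v n x) x|).
    by rewrite -normrN ler_norm.
  apply: le_trans (norm1_on_le mD (semigroup_L1 t0 dL)) _.
  apply: le_trans (semigroup_norm1 t0 dL) _.
  rewrite le_eqVlt; apply/orP; left; apply/eqP; congr fine.
  by apply: eq_integral => x _; rewrite /= distrC.
apply/ler_addgt0Pl => e e0.
have /fine_cvgP[_ /cvgrPdist_lt/(_ e e0)[n _ /(_ n (leqnn n))]] := vcvg.
rewrite /= sub0r normrN => ne; rewrite -lerBlDl sub0r.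
by apply: le_trans (low n); rewrite lerN2 (le_trans (ler_norm _))// ltW.
Unshelve. all: by end_near. Qed.

Lemma semigroup_functional D t : measurable D -> (mu D < +oo)%E -> 0 < t ->
  sub_probability_functional (fun f => \int[mu]_(x in D) T t f x) (fine (mu D)).
Proof.
move=> mD muD t0; split => [a f g fL gL|f fL|f fL f0|B mB muB].
- exact: semigroup_linear.
- apply: le_trans (norm1_on_le mD (semigroup_L1 t0 fL)) _.
  exact: semigroup_norm1.
- exact: semigroup_ge0.
- have BL := L1_indic mB muB.
  have TB1 : {ae mu, forall x, 0 <= T t \1_B x <= 1}.
    apply: (sg_sub_markovian TP t0 (Lp_onT BL)); apply: aeW => x.
    by rewrite indicE lern1 ler0n leq_b1.
  have cD := integrable_cst_on 1 mD muD.
  have TBD := L1_on mD (semigroup_L1 t0 BL).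
  rewrite -[fine (mu D)]mul1r -Rintegral_cst// -subr_ge0 -RintegralB//.
  apply: Rintegral_ae_ge0 => //; first exact: (integrableB mD cD TBD).
  by apply: filterS TB1 => x /andP[_]; rewrite subr_ge0.
Qed.

End semigroup.
End integral_functionals.

(** * Discrete Gronwall argument for the semigroup *)

Section lyapunov_semigroup.
Variables (R : realType) (d : nat).
Local Notation E := 'rV[R]_d.
Variable mu : {measure set E -> \bar R}.
Implicit Types (f g w : E -> R) (D B : set E).

Local Notation L1 f := (mu.-integrable setT (EFin \o f)).
Local Notation norm1 f := (\int[mu]_x `|f x|)%R.

Lemma functionalZ J c a f : sub_probability_functional mu J c -> L1 f ->
  J (fun x => a * f x) = a * J f.
Proof.
move=> JP fL; have z : L1 (fun=> 0 : R) by exact: integrable0.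
have zE : (fun=> 0 : R) = (fun x : E => (-1) * 0 + 0).
  by apply/funext => x; rewrite mulr0 addr0.
have J0 : J (fun=> 0) = 0 by rewrite {1}zE (functional_linear JP)//; ring.
have -> : (fun x => a * f x) = (fun x => a * f x + 0).
  by apply/funext => x; rewrite addr0.
by rewrite (functional_linear JP)// J0 addr0.
Qed.

(** For g = [T h f] and w the image of f under the generator: g is f + h w up to an L^1 error h
    delta, which J does not enlarge, and the lower bound on w passes through J by positivity. *)
Lemma functional_step J c alpha beta delta h f g w B :
  sub_probability_functional mu J c -> 0 < h -> 0 <= beta ->
  L1 f -> L1 g -> L1 w -> measurable B -> (mu B < +oo)%E ->
  norm1 (fun x => h^-1 * (g x - f x) - w x) <= delta ->
  {ae mu, forall x, alpha * f x - beta * \1_B x <= w x} ->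
  (1 + alpha * h) * J f - h * (beta * c + delta) <= J g.
Proof.
move=> JP h0 beta0 fL gL wL mB muB hdelta wge.
have BL := L1_indic mB muB.
have qL : L1 (fun x => h^-1 * (g x - f x)) by apply: L1Z; exact: L1B.
have gE : g = (fun x => h * (h^-1 * (g x - f x)) + f x).
  by apply/funext => x; rewrite mulrA divff ?gt_eqF// mul1r subrK.
have Jq : J w - delta <= J (fun x => h^-1 * (g x - f x)).
  rewrite lerBlDr -lerBlDl -(functionalB JP)//; apply: le_trans hdelta.
  have -> : (fun x => w x - h^-1 * (g x - f x)) =
      (fun x => (-1) * (h^-1 * (g x - f x) - w x)).
    by apply/funext => x; ring.
  have dL : L1 (fun x => h^-1 * (g x - f x) - w x) by exact: L1B.
  rewrite (functionalZ _ JP)// mulN1r.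
  apply: le_trans (functional_norm JP dL).
  by rewrite -normrN ler_norm.
have Jw : alpha * J f - beta * c <= J w.
  have fB : L1 (fun x => alpha * f x - beta * \1_B x).
    by apply: L1B; apply: L1Z.
  apply: le_trans (functional_le JP fB wL wge).
  rewrite (functionalB JP); [|exact: L1Z|exact: L1Z].
  rewrite !(functionalZ _ JP)// lerD2l lerN2 ler_wpM2l//.
  exact: functional_indic JP _ mB muB.
rewrite [in leRHS]gE (functional_linear JP)//.
have := ler_wpM2l (ltW h0) (le_trans (lerB Jw (lexx delta)) Jq).
lra.
Qed.

(** The recursion reads b - a_(k+1) <= (1 + u) (b - a_k) + v, and each of the n errors v is
    amplified at most by (1 + u)^n. *)
Lemma discrete_gronwall (a : nat -> R) (b u v : R) n : 0 <= u -> 0 <= v ->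
  (forall k, (1 + u) * a k - (u * b + v) <= a k.+1) ->
  b - (1 + u) ^+ n * (b - a 0%N + n%:R * v) <= a n.
Proof.
move=> u0 v0 ak; elim: n => [|n IHn]; first by rewrite expr0 mul1r; lra.
have u1 : 0 <= 1 + u by lra.
have p1 : 1 <= (1 + u) ^+ n.+1 by rewrite exprn_ege1//; lra.
have := ler_wpM2l u1 IHn; have := ak n.
have : v <= (1 + u) ^+ n.+1 * v by rewrite ler_peMl.
rewrite -(natr1 n) exprS; set P := (1 + u) ^+ n; set a0 := a 0%N.
have -> : (1 + u) * P * (b - a0 + (n%:R + 1) * v) =
  (1 + u) * (P * (b - a0 + n%:R * v)) + (1 + u) * P * v by ring.
move: (P * (b - a0 + n%:R * v)) => Z; rewrite !mulrBr; lra.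
Qed.

Variable T : R -> (E -> R) -> (E -> R).
Hypothesis TP : sub_markovian_C0_contraction_semigroup mu setT T.

(* With [alpha * b = beta * mu D], this says that [b - f] is, in the mean over
   [D], at most multiplied by [exp (alpha t)] at time [t]. *)
Lemma lyapunov_semigroup D B t alpha beta f w :
  measurable D -> (mu D < +oo)%E -> measurable B -> (mu B < +oo)%E ->
  0 < t -> 0 < alpha -> 0 <= beta -> generator mu setT T f w ->
  {ae mu, forall x, alpha * f x - beta * \1_B x <= w x} ->
  let b := beta * fine (mu D) / alpha in \int[mu]_(x in D) f x <= b ->
  b - expR (alpha * t) * (b - \int[mu]_(x in D) f x) <= \int[mu]_(x in D) T t f x.
Proof.
move=> mD muD mB muB t0 alpha0 beta0 [/Lp_onT_integrable fL /Lp_onT_integrable wL Tfw] wge b.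
set a0 := \int[mu]_(x in D) f x => a0b.
have eps (e : R) : 0 < e ->
    b - expR (alpha * t) * (b - a0 + t * e) <= \int[mu]_(x in D) T t f x.
  move=> e0.
  have [r /= r0 rP] : exists2 r, 0 < r & forall h : R, 0 < h -> h < r ->
      norm1 (fun x => h^-1 * (T h f x - f x) - w x) <= e.
    have : at_right (0 : R) [set h : R |
        (Lp_dist mu 1 (fun x => (h^-1 * (T h f x - f x))%R) w < e%:E)%E].
      apply: (Tfw [set y | (y < e%:E)%E]); apply: open_nbhs_nbhs; split.
        exact: open_ereal_lt_ereal.
      by rewrite /= lte_fin.
    rewrite /at_right /= => /nbhs_ballP[r /= r0 rP]; exists r => // h h0 hr.
    have := rP h; rewrite /ball/= sub0r normrN gtr0_norm// => /(_ hr h0).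
    rewrite /Lp_dist Lnorm1_norm1; first by rewrite lte_fin => /ltW.
    apply: L1B => //; apply: L1Z; apply: L1B => //; exact: (semigroup_L1 TP).
  have [n nP] : exists n : nat, t / n.+1%:R < r.
    exists (Num.bound (t / r)); rewrite ltr_pdivrMr ?ltr0n//.
    rewrite mulrC -ltr_pdivrMr//.
    apply: (lt_trans (archi_boundP _)); first by rewrite divr_ge0// ltW.
    by rewrite ltr_nat.
  set h := t / n.+1%:R in nP.
  have h0 : 0 < h by rewrite divr_gt0// ltr0n.
  have ThL := semigroup_L1 TP h0 fL.
  have step := rP h h0 nP.
  (* The semigroup is specified at positive times only, hence the separate value at 0. *)
  pose a k := if k is k'.+1 then \int[mu]_(x in D) T (k'.+1%:R * h) f x else a0.
  have ak k : (1 + alpha * h) * a k - (alpha * h * b + h * e) <= a k.+1.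
    have -> : alpha * h * b + h * e = h * (beta * fine (mu D) + e).
      by rewrite /b; field; rewrite gt_eqF.
    case: k => [|k].
      rewrite /= mul1r; apply: (functional_step (integral_functional mD muD)
        h0 beta0 fL ThL wL mB muB step wge).
    have kh0 : 0 < k.+1%:R * h by rewrite mulr_gt0// ltr0n.
    (* The small step h is put innermost: f and [T h f] are compared under the functional of time (k
       + 1) h, so the generator is applied to f and never to a later iterate. *)
    have -> : a k.+2 = \int[mu]_(x in D) T (k.+1%:R * h) (T h f) x.
      rewrite /a; apply: eq_ae_Rintegral => //.
      - by apply: (semigroup_L1 TP) => //; rewrite mulr_gt0// ltr0n.
      - exact: (semigroup_L1 TP).
      - have -> : k.+2%:R * h = k.+1%:R * h + h by rewrite -(natr1 k.+1) mulrDl mul1r.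
        exact: (sg_add TP kh0 h0 (Lp_onT fL)).
    exact: (functional_step (semigroup_functional TP mD muD kh0)
        h0 beta0 fL ThL wL mB muB step wge).
  have u0 : 0 <= alpha * h by rewrite mulr_ge0// ltW.
  have v0 : 0 <= h * e by rewrite mulr_ge0// ltW.
  have := discrete_gronwall n.+1 u0 v0 ak.
  have nh : n.+1%:R * h = t by rewrite /h mulrC divfK// pnatr_eq0.
  have -> : a n.+1 = \int[mu]_(x in D) T t f x by rewrite /= nh.
  apply: le_trans; rewrite lerD2l lerN2 [_%:R * _]mulrA nh.
  (* By [a0b] the bracket is nonnegative, so (1 + alpha h)^(n+1) may be replaced by exp(alpha t). *)
  rewrite ler_wpM2r//; first by rewrite addr_ge0 ?subr_ge0// mulr_ge0// ltW.
  have -> : alpha * t = n.+1%:R * (alpha * h) by rewrite mulrCA nh.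
  rewrite expRM_natl.
  by rewrite lerXn2r ?nnegrE ?expR_ge0 ?expR_ge1Dx// addr_ge0.
apply/ler_addgt0Pr => e e0.
have te0 : 0 < expR (alpha * t) * t by rewrite mulr_gt0 ?expR_gt0.
have := eps (e / (expR (alpha * t) * t)) (divr_gt0 e0 te0).
have -> : expR (alpha * t) * (b - a0 + t * (e / (expR (alpha * t) * t))) =
   expR (alpha * t) * (b - a0) + e.
  by field; rewrite !gt_eqF ?expR_gt0.
lra.
Qed.

End lyapunov_semigroup.

(** * Non-explosion *)

Section conservativeness.
Variables (R : realType) (d : nat).
Local Notation E := 'rV[R]_d.

Lemma measurable_fun_continuous_rV (f : E -> R) : continuous f -> measurable_fun setT f.
Proof.
move=> cf; apply: (measurability _ (RGenOpens.measurableE R)).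
move=> _ [_ [a [b ->]] <-]; rewrite setTI; apply: measurable_open_rV.
by apply: open_comp; [move=> x _; exact: cf|exact: interval_open].
Qed.

Variables (p K : R) (N0 : nat) (A C : E -> 'M[R]_d) (H : E -> E) (rho : E -> R).
Variable mu : {measure set E -> \bar R}.
Variables T P : R -> (E -> R) -> (E -> R).
Hypothesis aA : assumption_a p A C H.
Hypothesis rhomu : invariant_density p A (driftG A C H) rho mu.
Hypothesis TP : sub_markovian_C0_contraction_semigroup mu setT T.
Hypothesis gen : forall f, test_fun setT f ->
  generator mu setT T f (operL A (driftG A C H) f).
Hypothesis PT : continuous_versions mu T P.
Hypothesis K0 : 0 < K.
Hypothesis growth : {ae @lebesgue_rV R d, forall x, N0%:R < enorm x ->
  - (dot (mxact (A x) x) x / enorm x ^+ 2) + 2^-1 * \tr (A x)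
    + dot (driftG A C H x) x
  <= K * enorm x ^+ 2 * (ln (enorm x) + 1)}.

Local Notation L1 f := (mu.-integrable setT (EFin \o f)).

Let cutoff_L1 (r0 m : R) : L1 (fun x : E => cutoff r0 m (sqnorm x)).
Proof. by have [/Lp_onT_integrable] := gen (@test_fun_cutoff R d r0 m). Qed.

(** Cutoffs lie in L^1(mu), being in the domain of the generator. For m = 2 (|c| + 1) the cutoff is
    at least 1/2 on the ball, so its double dominates the indicator. *)
Lemma sqnorm_ball_lty (c : R) (B : set E) : measurable B ->
  B `<=` [set x | sqnorm x <= c] -> (mu B < +oo)%E.
Proof.
move=> mB Bc; pose m := 2 * (`|c| + 1).
have m0 : 0 < m by rewrite mulr_gt0// ltr_wpDl.
have fL := L1Z 2 (cutoff_L1 0 m).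
have /integrableP[_] : L1 (\1_B : E -> R).
  apply: (le_integrable measurableT _ _ fL).
    by apply/measurable_EFinP; exact: measurable_indic.
  move=> x _ /=; rewrite lee_fin normrM !ger0_norm ?cutoff_ge0//.
  rewrite indicE; case: (boolP (x \in B)) => [/set_mem /Bc /= xc|_]; last first.
    by rewrite mulr_ge0// cutoff_ge0.
  have : 1 - (sqnorm x + 1) / m <= cutoff 0 m (sqnorm x).
    by apply: cutoff_ge => //; exact: dot_self_ge0.
  suff : (sqnorm x + 1) / m <= 2^-1 by rewrite /=; lra.
  rewrite ler_pdivrMr// /m mulrA mulVf ?pnatr_eq0// mul1r lerD2r.
  exact: le_trans xc (ler_norm c).
rewrite (eq_integral (fun x => (\1_B x)%:E)); last first.
  by move=> x _; rewrite gee0_abs// lee_fin.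
by rewrite integral_indic// setIT.
Qed.

Lemma semigroup_indic_mass (D : set E) (c0 t e : R) : measurable D ->
  D `<=` [set x | sqnorm x <= c0] -> 0 < t -> 0 < e ->
  exists r : R, forall B, measurable B -> (mu B < +oo)%E ->
    [set x | sqnorm x < r] `<=` B ->
    fine (mu D) - e <= \int[mu]_(x in D) T t \1_B x.
Proof.
move=> mD Dc0 t0 e0.
have muD := sqnorm_ball_lty mD Dc0.
set c := fine (mu D); have c_ge0 : 0 <= c by exact: fine_ge0.
have [r0 [alpha [q [r00 alpha0 q0 lyap]]]] := cutoff_lyapunov_operator N0 aA K0.
(* The loss of mass at time t is at most k / m: the part with q / alpha is the excess of b over the
   mass of D, the part with |c0| + 1 bounds the integral of 1 - f over D. The choice of m makes k /
   m <= e. *)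
pose k := expR (alpha * t) * (c * (q / alpha + `|c0| + 1)).
have k_ge0 : 0 <= k.
  by rewrite mulr_ge0 ?expR_ge0// mulr_ge0// !addr_ge0// divr_ge0// ltW.
pose m := k / e + 1.
have m0 : 0 < m by rewrite ltr_wpDl// divr_ge0// ltW.
have kme : k / m <= e.
  by rewrite ler_pdivrMr// /m mulrDr mulr1 mulrCA divff ?gt_eqF// mulr1 lerDl ltW.
exists (r0 + expR m) => B mB muB rB.
pose f (x : E) := cutoff r0 m (sqnorm x).
pose V := [set x : E | sqnorm x < r0 + expR m].
have mV : measurable V by apply: measurable_open_rV; exact: open_sqnorm_ball.
have muV : (mu V < +oo)%E.
  by apply: (@sqnorm_ball_lty (r0 + expR m)) => // x /ltW.
have fL : L1 f by exact: cutoff_L1.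
have beta0 : 0 <= alpha + q / m by rewrite addr_ge0 ?divr_ge0// ltW.
have wge : {ae mu, forall x, alpha * f x - (alpha + q / m) * \1_V x <=
    operL A (driftG A C H) f x}.
  by apply: (density_ae rhomu); apply: filterS growth => x; exact: lyap.
have J0 := integral_functional mD muD.
have Jt := semigroup_functional TP mD muD t0.
have cD a := integrable_cst_on a mD muD.
have fD := L1_on mD fL.
have fc : \int[mu]_(x in D) f x <= c.
  rewrite -[c]mul1r -Rintegral_cst//; apply: le_Rintegral => // [|x _].
    exact: cD.
  exact: cutoff_le1.
have cf : c - c * (`|c0| + 1) / m <= \int[mu]_(x in D) f x.
  have -> : c - c * (`|c0| + 1) / m = (1 - (`|c0| + 1) / m) * c by ring.
  rewrite -Rintegral_cst//; apply: le_Rintegral => // [|x Dx].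
    exact: cD.
  apply: (@le_trans _ _ (1 - (sqnorm x + 1) / m)).
    rewrite lerD2l lerN2 ler_pM2r ?invr_gt0// lerD2r.
    exact: le_trans (Dc0 _ Dx) (ler_norm c0).
  by apply: cutoff_ge => //; exact: dot_self_ge0.
have bE : (alpha + q / m) * c / alpha = c + c * (q / alpha) / m.
  by field; rewrite !gt_eqF.
have cq0 : 0 <= c * (q / alpha) / m.
  by rewrite divr_ge0 ?(ltW m0)// mulr_ge0// divr_ge0// ltW.
have fb : \int[mu]_(x in D) f x <= c + c * (q / alpha) / m by lra.
have := lyapunov_semigroup TP mD muD mV muV t0 alpha0 beta0
  (gen (@test_fun_cutoff R d r0 m)) wge.
rewrite /= -/c bE => /(_ fb) low; apply: (@le_trans _ _ (\int[mu]_(x in D) T t f x)); last first.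
  apply: (functional_le Jt fL (L1_indic mB muB)); apply: aeW => x.
  rewrite indicE; case: (boolP (x \in B)) => [_|]; first exact: cutoff_le1.
  rewrite notin_setE => xB; rewrite /f.
  have [|/cutoff_eq0[-> _ _]//] := ltP (sqnorm x) (r0 + expR m).
  by move/(rB x).
apply: le_trans low.
have kE : k / m = expR (alpha * t) * (c * (q / alpha) / m + c * (`|c0| + 1) / m).
  by rewrite /k; field; rewrite !gt_eqF.
have : expR (alpha * t) * (c + c * (q / alpha) / m - \int[mu]_(x in D) f x) <= k / m.
  by rewrite kE ler_wpM2l ?expR_ge0//; lra.
lra.
Qed.

Lemma Lfun_pinfty_cst1 : (cst 1 : E -> R) \in Lfun mu +oo%E.
Proof.
rewrite inE; apply/andP; split; rewrite inE/=; first exact: measurable_cst.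
rewrite /finite_norm unlock; case: ifPn => // mu0.
apply: (@le_lt_trans _ _ 1%E); last exact: ltry.
by apply/ess_supP; apply: aeW => x /=; rewrite normr1.
Qed.

(** [P t 1] is the a.e. limit of T_t applied to indicators of balls. These functions lie between 0
    and 1, so dominated convergence on D passes [semigroup_indic_mass] to the limit. *)
Lemma conservative_mean (D : set E) (c0 t : R) : measurable D ->
  D `<=` [set x | sqnorm x <= c0] -> 0 < t ->
  mu.-integrable D (EFin \o P t (cst 1)) /\
  fine (mu D) <= \int[mu]_(x in D) P t (cst 1) x.
Proof.
move=> mD Dc0 t0; have muD := sqnorm_ball_lty mD Dc0.
pose B n := [set y : E | enorm y < n%:R].
have BE n : B n = [set x : E | sqnorm x < n%:R ^+ 2].
  apply/seteqP; split => x; rewrite /B/= -enorm_sqr.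
    by rewrite ltr_pXn2r ?nnegrE ?sqrtr_ge0//.
  by rewrite ltr_pXn2r ?nnegrE ?sqrtr_ge0//.
have mB n : measurable (B n).
  by rewrite BE; apply: measurable_open_rV; exact: open_sqnorm_ball.
have muB n : (mu (B n) < +oo)%E.
  by apply: (@sqnorm_ball_lty (n%:R ^+ 2)) => // x; rewrite BE => /ltW.
have B1 n : ((cst 1 : E -> R) \_ (B n)) = \1_(B n).
  by apply/funext => x; rewrite /patch indicE; case: ifPn.
have BL n := L1_indic (mB n) (muB n).
have one_le : (1 <= +oo :> \bar R)%E by exact: leey.
have Pcvg := P_version PT one_le Lfun_pinfty_cst1 t0.
have TB01 : {ae mu, forall x n, 0 <= T t \1_(B n) x <= 1}.
  apply: ae_foralln => n; apply: (sg_sub_markovian TP t0 (Lp_onT (BL n))).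
  by apply: aeW => x; rewrite indicE lern1 ler0n leq_b1.
have mTB n := measurable_int _ (L1_on mD (semigroup_L1 TP t0 (BL n))).
have mP : measurable_fun D (EFin \o P t (cst 1)).
  apply/measurable_EFinP; apply: measurable_funTS.
  apply: measurable_fun_continuous_rV.
  exact: (P_continuous PT one_le Lfun_pinfty_cst1 t0).
have [//|||||PL _ cvgI] := @dominated_convergence _ _ _ mu D mD
    (fun n => EFin \o T t \1_(B n)) (EFin \o P t (cst 1)) (EFin \o cst 1).
- exact: mP.
- apply: filterS Pcvg => x Px _; apply: cvg_EFin; first exact: nearW.
  by under eq_fun do rewrite -B1.
- exact: integrable_cst_on.
- apply: filterS TB01 => x TBx n _ /=; rewrite lee_fin ger0_norm.
    by have /andP[] := TBx n.
  by have /andP[] := TBx n.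
have /fine_cvgP[_ cvgR] : (\int[mu]_(x in D) (EFin \o T t \1_(B n)) x)%E @[n --> \oo] -->
    ((\int[mu]_(x in D) P t (cst 1) x)%:E).
  rewrite /Rintegral fineK//; exact: (integrable_fin_num mD PL).
split; [exact: PL|apply/ler_addgt0Pl => e e0].
have [r rP] := semigroup_indic_mass mD Dc0 t0 e0.
rewrite -lerBlDl; apply: (cvgr_to_ge cvgR).
near=> n; apply: (rP (B n)) => // x; rewrite BE/= => /lt_le_trans; apply.
have rn : `|r| + 1 <= n%:R by near: n; exact: nbhs_infty_ger.
have n1 : 1 <= n%:R :> R by apply: le_trans rn; rewrite lerDr.
apply: (@le_trans _ _ n%:R); last by rewrite expr2 ler_peMl// (le_trans _ n1).
by apply: le_trans rn; rewrite (le_trans (ler_norm r))// lerDl.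
Unshelve. all: by end_near. Qed.

(** Otherwise, by continuity, [P t 1] stays below some b < 1 on a bounded open neighbourhood D of x.
    Its integral over D is then at most b mu(D) < mu(D), against [conservative_mean]. *)
Lemma conservative_pointwise t x : 0 < t -> 1 <= P t (cst 1) x.
Proof.
move=> t0; rewrite leNgt; apply/negP => Px.
have one_le : (1 <= +oo :> \bar R)%E by exact: leey.
have cP := P_continuous PT one_le Lfun_pinfty_cst1 t0.
pose b := (P t (cst 1) x + 1) / 2.
pose D := [set y | P t (cst 1) y < b] `&` [set y : E | sqnorm y < sqnorm x + 1].
have oD : open D.
  apply: openI; last exact: open_sqnorm_ball.
  apply: (@open_comp _ _ (P t (cst 1)) [set r | r < b]) => [y _|].
    exact: cP.
  exact: open_lt.
have mD := measurable_open_rV oD.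
have Dx : D x by split; rewrite /b/=; lra.
have Dc : D `<=` [set y | sqnorm y <= sqnorm x + 1] by move=> y [_ /ltW].
have muD := sqnorm_ball_lty mD Dc.
have c0 : 0 < fine (mu D).
  by rewrite fine_gt0// muD andbT; apply: (density_open_gt0 rhomu) => //; exists x.
have [PD] := conservative_mean mD Dc t0.
apply/negP; rewrite -ltNge.
have b1 : b < 1 by rewrite /b; lra.
apply: (@le_lt_trans _ _ (b * fine (mu D))); last first.
  by rewrite -[ltRHS]mul1r ltr_pM2r.
rewrite -Rintegral_cst//; apply: le_Rintegral => //.
  exact: integrable_cst_on.
by move=> y [/ltW].
Qed.

End conservativeness.

(** * From P_t 1 = 1 to an infinite lifetime *)

Section lifetime.
Variables (R : realType) (d : nat) (dO : measure_display).
Variables (Omega : measurableType dO) (M : hunt_process R d Omega).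
Local Notation E := 'rV[R]_d.
Local Notation ED := (one_point_compactification E).

Definition alive (t : R) : set Omega := [set w | hX M t w <> None].

Lemma measurable_alive t : 0 <= t -> measurable (alive t).
Proof.
move=> t0; apply: (hF_measurable t0).
have -> : alive t = hX M t @^-1` (Some @` [set: E]).
  apply/seteqP; split => w; rewrite /alive/=.
    by case: (hX M t w) => [x|//] _; exists x.
  by move=> [x _ <-].
apply: hX_adapted => //; apply: sub_sigma_algebra.
by apply: one_point_compactification_open_some; exact: openT.
Qed.

(** The cemetery is absorbing, so a path that reaches it at time t is still there at every later
    integer. The times n + 1 are positive, as the bound on [P t 1] requires. *)
Lemma lifetime_pinftyE :
  [set w | lifetime M w = +oo%E] = \bigcap_n alive n.+1%:R.
Proof.
apply/seteqP; split => [w /= Mw n _ Xn|w Xw].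
  suff : (lifetime M w <= n.+1%:R%:E)%E by rewrite Mw.
  by apply: ereal_inf_lbound; exists n.+1%:R.
rewrite /= /lifetime (_ : [set _ | _ in _] = set0) ?ereal_inf0//.
apply/seteqP; split => // y [t [t0 Xt] _] /=.
apply: (Xw (Num.bound t) I).
apply: (hX_absorbed t0 _ Xt); apply/ltW.
by apply: (lt_trans (archi_boundP t0)); rewrite ltr_nat.
Qed.

Lemma non_explosive_alive : (forall t x, 0 < t -> hP M (Some x) (alive t) = 1%E) ->
  non_explosive M.
Proof.
move=> h x; rewrite lifetime_pinftyE.
have mA n : measurable (alive n.+1%:R) by exact: measurable_alive.
have mI : measurable (\bigcap_n alive n.+1%:R) by exact: bigcapT_measurable.
rewrite -[\bigcap_n _]setCK probability_setC; last exact: measurableC.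
rewrite setC_bigcap (_ : hP M (Some x) _ = 0%E) ?sube0//.
apply/negligibleP; first by apply: bigcupT_measurable => n; exact: measurableC.
apply: negligible_bigcup => n; apply/negligibleP; first exact: measurableC.
apply: etrans (probability_setC (hP M (Some x)) (mA n)) _.
by rewrite h ?ltr0n// subee.
Qed.

(** Since functions are extended by 0 at the cemetery, [P t 1] at x is the probability of being
    alive at time t. *)
Lemma transition_alive (P : R -> (E -> R) -> (E -> R)) t x :
  has_transition P M -> 0 <= t -> 1 <= P t (cst 1) x ->
  hP M (Some x) (alive t) = 1%E.
Proof.
move=> PM t0; rewrite (PM t x (cst 1)) //; last by exists 1 => y; rewrite normr1.
have mA := measurable_alive t0.
have -> : (\int[hP M (Some x)]_w oapp (cst 1) 0 (hX M t w)) = fine (hP M (Some x) (alive t)).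
  rewrite -[alive t in RHS]setIT -integral_indic//; congr fine.
  apply: eq_integral => w _; congr EFin; rewrite indicE /alive.
  case Xw : (hX M t w) => [y|] /=; first by rewrite mem_set//= Xw.
  by rewrite memNset//= Xw; apply.
move=> h; apply/eqP; rewrite eq_le probability_le1//=.
by rewrite -[leRHS]fineK ?fin_num_measure// lee_fin.
Qed.

End lifetime.

Theorem corollary3p27 (R : realType) (d : nat) (p : R)
    (A C : 'rV[R]_d -> 'M[R]_d) (H : 'rV[R]_d -> 'rV[R]_d)
    (rho : 'rV[R]_d -> R) (mu : {measure set 'rV[R]_d -> \bar R})
    (T P : R -> ('rV[R]_d -> R) -> ('rV[R]_d -> R))
    (dO : measure_display) (Omega : measurableType dO)
    (M : hunt_process R d Omega) :
  (2 <= d)%N -> d%:R < p ->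
  assumption_a p A C H ->
  assumption_b p A C H ->
  invariant_density p A (driftG A C H) rho mu ->
  associated_semigroup mu A (driftG A C H)
    (fun x => driftG A C H x - beta rho A x) T ->
  continuous_versions mu T P ->
  has_transition P M ->
  (exists (K : R) (N0 : nat), 0 < K /\
    {ae @lebesgue_rV R d, forall x, N0%:R < enorm x ->
      - (dot (mxact (A x) x) x / enorm x ^+ 2) + 2^-1 * \tr (A x)
        + dot (driftG A C H x) x
      <= K * enorm x ^+ 2 * (ln (enorm x) + 1)}) ->
  non_explosive M.
Proof.
move=> _ _ aA _ rhomu [GV [Gr [_ _ TP _ gen]]] PT PM [K [N0 [K0 growth]]].
apply: non_explosive_alive => t x t0.
apply: (transition_alive PM (ltW t0)).
exact: (conservative_pointwise aA rhomu TP gen PT K0 growth).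
Qed.
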